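(* Let $X$ and $Y$ be Banach spaces over $\mathbb{K}\in\{\mathbb{R},\mathbb{C}\}$, $\Gamma$ an arbitrary set, $E$ an invariant sequence space over $X$, and for each $\lambda\in\Gamma$ let $F_\lambda$ be a strongly invariant sequence space over $\mathbb{K}$. Suppose $f\colon X\to Y$ is strongly compatible with $F_\lambda^w(Y)$ for every $\lambda\in\Gamma$, and that the family $(F_\lambda^w(Y))_{\lambda\in\Gamma}$ is nested. Then the set $$G^w\big(E,f,(F_\lambda)_{\lambda\in\Gamma}\big)=\Big\{(x_j)_{j=1}^\infty\in E:\ (f(x_j))_{j=1}^\infty\notin\bigcup_{\lambda\in\Gamma}F^w_\lambda(Y)\Big\}$$ is either empty or pointwise $\mathfrak{c}$-spaceable in $E$; i.e., if it is nonempty, then for every $x$ in it there is a closed linear subspace $W_x$ of $E$ with $\dim W_x=\mathfrak{c}$ and $x\in W_x\subset G^w(E,f,(F_\lambda)_{\lambda\in\Gamma})\cup\{0\}$.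
   Context: $\mathfrak{c}=\operatorname{card}(\mathbb{R})$; $Y'$ denotes the topological dual of $Y$. Zero-free version: for $x=(x_j)_{j=1}^\infty\in Z^{\mathbb{N}}$ ($Z$ a Banach space), if $x$ has only finitely many nonzero coordinates then $x^0=0$; otherwise $x^0=(x_{j_k})_{k=1}^\infty$ where $x_{j_k}$ is the $k$-th nonzero coordinate of $x$. An invariant sequence space over a Banach space $Z\neq\{0\}$ is an infinite-dimensional Banach or quasi-Banach space $E$ which is a linear subspace of $Z^{\mathbb{N}}$ (coordinatewise operations) such that: (b1) there is a constant $K$ depending only on $E$ such that for all $x\in Z^{\mathbb{N}}$ with $x^0\neq0$, $x\in E\iff x^0\in E$, and $\|x\|_E\le K\|x^0\|_E$; (b2) $\|x_j\|_Z\le\|x\|_E$ for all $x=(x_j)\in E$ and all $j$. A strongly invariant sequence space over $Z$ is an invariant sequence space $E$ over $Z$ such that $c_{00}(Z)=\{(x_j)\in Z^{\mathbb{N}}: x_j=0\text{ for all but finitely many }j\}\subset E$, and $(x_j)_{j=1}^\infty\in E$ if and only if every subsequence of $(x_j)_{j=1}^\infty$ belongs to $E$. For an invariant sequence space $F$ over $\mathbb{K}$, $F^w(Y)=\{(y_j)_{j=1}^\infty\in Y^{\mathbb{N}}: (\varphi(y_j))_{j=1}^\infty\in F\text{ for all }\varphi\in Y'\}$. If $F$ is an invariant sequence space over $\mathbb{K}$, a function $g\colon X\to\mathbb{K}$ with $g(0)=0$ is compatible with $F$ if for every $X$-valued sequence $(x_j)$ and every scalar $a\neq0$: $(g(x_j))_j\notin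 F\Rightarrow(g(ax_j))_j\notin F$. A map $f\colon X\to Y$ with $f(0)=0$ is strongly compatible with $F^w(Y)$ if $\varphi\circ f$ is compatible with $F$ for every $\varphi\in Y'$. A family $(A_\lambda)_{\lambda\in\Gamma}$ of sets is nested if for all $\lambda_1,\lambda_2\in\Gamma$, either $A_{\lambda_1}\subset A_{\lambda_2}$ or $A_{\lambda_2}\subset A_{\lambda_1}$. *)

(* Defs.v *)
From HB Require Import structures.
From mathcomp Require Import all_boot all_order all_algebra.
From mathcomp Require Import all_classical all_reals all_analysis.
From mathcomp Require Import complex.
Set Implicit Arguments.
Unset Strict Implicit.
Unset Printing Implicit Defensive.
Import Order.TTheory GRing.Theory Num.Theory.
Import numFieldNormedType.Exports.
Local Open Scope classical_set_scope.
Local Open Scope ring_scope.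

Definition R_or_C (R : realType) (K : numFieldType) : Prop :=
  (exists f : {rmorphism R -> K}, bijective f /\ forall x : R, `|f x| = f `|x|)
  \/ (exists f : {rmorphism R[i] -> K}, bijective f /\
        forall z : R[i], `|f z| = f `|z|).

Section LinAlg.
Context {K : numFieldType} {V : lmodType K}.

Definition lincomb (c : seq K) (s : seq V) : V :=
  \sum_(i < size s) c`_i *: s`_i.

Definition lin_indep (B : set V) : Prop :=
  forall (s : seq V) (c : seq K), uniq s -> size c = size s ->
    (forall v, v \in s -> B v) -> lincomb c s = 0 ->
    forall i, (i < size s)%N -> c`_i = 0.

Definition span (B : set V) : set V :=
  [set w | exists (s : seq V) (c : seq K), (forall v, v \in s -> B v) /\
           size c = size s /\ w = lincomb c s].

Definition linear_subspace (W : set V) : Prop :=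
  W 0 /\ (forall u v, W u -> W v -> W (u + v)) /\
  (forall (a : K) u, W u -> W (a *: u)).

Definition hamel_dim_eq (T : Type) (W : set V) (S : set T) : Prop :=
  exists B : set V, B `<=` W /\ lin_indep B /\ (forall w, W w <-> span B w) /\
    (B #= S)%card.

Definition infinite_dim (W : set V) : Prop :=
  ~ exists s : seq V, forall w, W w <-> span [set v | v \in s] w.
End LinAlg.

Section SeqSpaces.
Context {K : numFieldType} {Z : normedModType K}.

Definition strictly_incr (phi : nat -> nat) : Prop := forall n, (phi n < phi n.+1)%N.

Definition finitely_supported (x : nat -> Z) : Prop :=
  exists N, forall j, (N <= j)%N -> x j = 0.

Definition zero_free_of (x y : nat -> Z) : Prop :=
  (finitely_supported x /\ y = 0) \/
  (~ finitely_supported x /\ exists phi : nat -> nat, strictly_incr phi /\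
      (forall j, x j != 0 <-> exists k, phi k = j) /\ y = (fun k => x (phi k))).

Definition quasi_banach (E : set (nat -> Z)) (qn : (nat -> Z) -> K) : Prop :=
  linear_subspace E /\
  (forall x, E x -> 0 <= qn x) /\
  (forall x, E x -> (qn x = 0 <-> x = 0)) /\
  (forall (a : K) x, E x -> qn (a *: x) = `|a| * qn x) /\
  (exists C : K, 1 <= C /\ forall x y, E x -> E y -> qn (x + y) <= C * (qn x + qn y)) /\
  (forall u : nat -> (nat -> Z), (forall n, E (u n)) ->
     (forall e : K, 0 < e -> exists N, forall m n, (N <= m)%N -> (N <= n)%N ->
          qn (u m - u n) < e) ->
     exists x, E x /\ forall e : K, 0 < e -> exists N, forall n, (N <= n)%N ->
          qn (u n - x) < e).

Definition inv_seq_space (E : set (nat -> Z)) (qn : (nat -> Z) -> K) : Prop :=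
  (exists z : Z, z != 0) /\
  quasi_banach E qn /\ infinite_dim E /\
  (exists K0 : K, forall x y : nat -> Z, zero_free_of x y -> y != 0 ->
      (E x <-> E y) /\ (E x -> qn x <= K0 * qn y)) /\
  (forall x, E x -> forall j, `|x j| <= qn x).

Definition strongly_inv_seq_space (E : set (nat -> Z)) (qn : (nat -> Z) -> K) : Prop :=
  inv_seq_space E qn /\
  (forall x, finitely_supported x -> E x) /\
  (forall x, E x <-> forall phi, strictly_incr phi -> E (fun k => x (phi k))).

Definition qn_closed (E : set (nat -> Z)) (qn : (nat -> Z) -> K) (W : set (nat -> Z)) : Prop :=
  forall x, E x -> (forall e : K, 0 < e -> exists w, W w /\ qn (x - w) < e) -> W x.
End SeqSpaces.

Section Weak.
Context {K : numFieldType}.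

Definition dual_elt {Y : normedModType K} (phi : Y -> K) : Prop :=
  (forall (a : K) (u v : Y), phi (a *: u + v) = a * phi u + phi v) /\ continuous phi.

Definition weak_seq {Y : normedModType K} (F : set (nat -> K)) : set (nat -> Y) :=
  [set y : nat -> Y | forall phi : Y -> K, dual_elt phi -> F (fun j => phi (y j))].

Definition compatible {X : normedModType K} (g : X -> K) (F : set (nat -> K)) : Prop :=
  g 0 = 0 /\ forall (x : nat -> X) (a : K), a != 0 ->
    ~ F (fun j => g (x j)) -> ~ F (fun j => g (a *: x j)).

Definition strongly_compatible {X Y : normedModType K} (f : X -> Y) (F : set (nat -> K)) : Prop :=
  f 0 = 0 /\ forall phi : Y -> K, dual_elt phi -> compatible (fun x => phi (f x)) F.

Definition nested {T Gam : Type} (A : Gam -> set T) : Prop :=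
  forall l1 l2, A l1 `<=` A l2 \/ A l2 `<=` A l1.

Definition Gw {X Y : normedModType K} {Gam : Type} (E : set (nat -> X)) (f : X -> Y)
  (F : Gam -> set (nat -> K)) : set (nat -> X) :=
  [set x | E x /\ ~ (exists l, @weak_seq Y (F l) (fun j => f (x j)))].
End Weak.

(* Main.v *)
Require Import Defs.
From HB Require Import structures.
From mathcomp Require Import all_boot all_order all_algebra.
From mathcomp Require Import all_classical all_reals all_analysis.
From mathcomp Require Import complex.
From mathcomp Require Import lra.
Set Implicit Arguments.
Unset Strict Implicit.
Unset Printing Implicit Defensive.
Import Order.TTheory GRing.Theory Num.Theory.
Import numFieldNormedType.Exports.
Local Open Scope classical_set_scope.
Local Open Scope ring_scope.

(** Let [x] belong to the set. If both [1_A f(x)] and [1_(~A) f(x)] belonged to spaces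
    [F l ^w(Y)], nestedness would put them in a common one, and then so would be their sum
    [f(x)]. Hence for [A] one of the two sets of indices of a given parity, [1_A f(x)] lies
    in no [F l ^w(Y)]. The zero-free version of [x] is copied onto infinitely many disjoint
    infinite subsets of the complement of [A], giving [y_0, y_1, ...] in [E], and [W] is the
    closed span of [x, y_0, y_1, ...]. An element of [W] is a multiple of [x] on [A] and, if
    that multiple is zero, a multiple of [y_n] on the [n]-th block; compatibility then
    shows that a nonzero element is outside every [F l ^w(Y)]. If the family is empty
    the set is [E], and [W] is the closed span of a linearly independent sequence.

    In a complete quasi-normed space over R or C the closed span of a linearly independent
    sequence [e_n] has dimension [c]. Finite-dimensional subspaces are closed, so [e_n] has
    positive distance to the span of its predecessors; after rescaling the [e_n] fast enough,
    [\sum c_n e_n = 0] with bounded [c] forces [c_n -> 0]. The sums of the [e_n] over the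
    branches of the binary tree, an almost disjoint family of [c] sets, are therefore
    linearly independent. *)

(** * Cardinal comparisons between the reals and the binary sequences *)

Lemma card_le_inj {T U : Type} (A : set T) (B : set U) (f : T -> U) :
  (forall x, A x -> B (f x)) -> (forall x y, A x -> A y -> f x = f y -> x = y) ->
  (A #<= B)%card.
Proof.
move=> fAB finj.
have h : (f @` A #= A)%card.
  by apply: inj_card_eq => x y /set_mem Ax /set_mem Ay; exact: finj.
apply: (@card_le_trans _ _ _ (f @` A)); first by move/card_eqPle: h => [].
by apply: subset_card_le => _ [x Ax <-]; exact: fAB.
Qed.

Lemma card_leT_inj {T U : Type} :
  ([set: T] #<= [set: U])%card -> exists f : T -> U, injective f.
Proof.
move=> /card_leP[f]; exists (fun x => val (f (to_setT x))) => x y /val_inj E.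
by have := inj (mem_setT _) (mem_setT _) E => -[].
Qed.

Section Continuum.
Variable R : realType.

Let ternary_sum (b : nat -> bool) n : R := \sum_(i < n) (b i)%:R * 3^-1 ^+ i.

Let ternary_sumS b n :
  ternary_sum b n.+1 = ternary_sum b n + (b n)%:R * 3^-1 ^+ n.
Proof. by rewrite /ternary_sum big_ord_recr. Qed.

Let ternary_sum_incr b : {homo ternary_sum b : m n / (m <= n)%N >-> m <= n}.
Proof.
apply: homo_leq => //; first by move=> y x z; apply: le_trans.
by move=> n; rewrite ternary_sumS lerDl mulr_ge0 // exprn_ge0.
Qed.

(** The term [3 / 2 * 3^-1 ^+ n] is the geometric tail from index [n] on with all digits equal to 1.
    Hence a partial sum plus its tail is an upper bound that never increases. *)
Let ternary_sum_tail b n k :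
  ternary_sum b (n + k) + 3 / 2 * 3^-1 ^+ (n + k) <=
    ternary_sum b n + 3 / 2 * 3^-1 ^+ n.
Proof.
elim: k => [|k IH]; first by rewrite addn0.
apply: le_trans IH; rewrite addnS ternary_sumS exprS.
have : 0 <= 3^-1 ^+ (n + k) :> R by rewrite exprn_ge0.
by case: (b _) => /=; lra.
Qed.

Let ternary_sum_ub b n m : ternary_sum b m <= ternary_sum b n + 3 / 2 * 3^-1 ^+ n.
Proof.
have p k : 0 <= 3^-1 ^+ k :> R by rewrite exprn_ge0.
have [nm|/ltnW mn] := leqP n m.
  have := ternary_sum_tail b n (m - n); rewrite subnKC // => h.
  by have := p m; lra.
by have := ternary_sum_incr b mn; have := p n; lra.
Qed.

(** Digits 0 and 1 in base 3 leave gaps: at the first index [n] where two sequences differ, the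
    digit 1 is worth [3^-n], while all later digits together are worth at most half of that. So the
    expansion is injective. *)
Lemma card_le_bool_seq_real : ([set: nat -> bool] #<= [set: R])%card.
Proof.
pose g b := sup (range (ternary_sum b)).
have hs b : has_sup (range (ternary_sum b)).
  split; first by exists (ternary_sum b 0); exists 0%N.
  by exists (ternary_sum b 0 + 3 / 2 * 3^-1 ^+ 0) => _ [m _ <-]; exact: ternary_sum_ub.
have gl b n : ternary_sum b n <= g b.
  by apply: ub_le_sup; [case: (hs b) | exists n].
have gu b n : g b <= ternary_sum b n + 3 / 2 * 3^-1 ^+ n.
  apply: ge_sup; first by case: (hs b).
  by move=> _ [m _ <-]; exact: ternary_sum_ub.
have key (b b' : nat -> bool) n : (forall i, (i < n)%N -> b i = b' i) -> b n -> ~~ b' n -> g b <> g b'.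
  move=> e bn b'n E.
  have := gl b n.+1; have := gu b' n.+1.
  rewrite E !ternary_sumS bn (negbTE b'n) /= exprS.
  have -> : ternary_sum b n = ternary_sum b' n.
    by apply: eq_bigr => i _; rewrite e.
  have : 0 < 3^-1 ^+ n :> R by rewrite exprn_gt0.
  by lra.
apply: (@card_le_inj _ _ _ _ g) => // b b' _ _ E.
apply: contrapT => nb.
have ex : exists n, b n != b' n.
  apply: contrapT => h; apply: nb; apply: funext => n.
  by apply/eqP; apply: contrapT => /negP hn; apply: h; exists n.
case: (ex_minnP ex) => n bn mn.
have e i : (i < n)%N -> b i = b' i.
  by move=> lin; apply/eqP; apply: contraLR lin => hi; rewrite -leqNgt; exact: mn.
case bE : (b n) bn => h.
- by apply: (key b b' n) => //; case: (b' n) h.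
- apply: (key b' b n); [by move=> i /e | by case: (b' n) h | by rewrite bE | by []].
Qed.

(** A real number is determined by its Dedekind cut, a set of rationals, and the rationals are
    numbered by [pickle]. *)
Lemma card_le_real_bool_seq : ([set: R] #<= [set: nat -> bool])%card.
Proof.
pose g (x : R) (n : nat) := if unpickle n is Some q then ratr (q : rat) < x else false.
apply: (@card_le_inj _ _ _ _ g) => // x y _ _ E.
have key a b : a < b -> g a <> g b.
  move=> ab Eab.
  have [q] := rat_in_itvoo ab; rewrite in_itv /= => /andP[aq qb].
  have := congr1 (fun h => h (pickle q)) Eab; rewrite /g pickleK qb.
  by rewrite ltNge (ltW aq).
case: (ltgtP x y) => // [/key|/key]; first by rewrite E.
by rewrite E.
Qed.
End Continuum.

Lemma card_le_fun (I T U : Type) :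
  ([set: T] #<= [set: U])%card -> ([set: I -> T] #<= [set: I -> U])%card.
Proof.
move=> /card_leT_inj[g ginj].
apply: (@card_le_inj _ _ _ _ (fun h i => g (h i))) => // h h' _ _ E.
by apply: funext => i; apply: ginj; exact: (congr1 (fun k => k i) E).
Qed.

Lemma card_le_prod (T1 T2 U1 U2 : Type) :
  ([set: T1] #<= [set: U1])%card -> ([set: T2] #<= [set: U2])%card ->
  ([set: T1 * T2] #<= [set: U1 * U2])%card.
Proof.
move=> /card_leT_inj[f finj] /card_leT_inj[g ginj].
apply: (@card_le_inj _ _ _ _ (fun x => (f x.1, g x.2))) => //.
by move=> [a b] [c d] _ _ /= [] /finj -> /ginj ->.
Qed.

Lemma card_le_bool_seq_prod :
  ([set: (nat -> bool) * (nat -> bool)] #<= [set: nat -> bool])%card.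
Proof.
pose g (x : (nat -> bool) * (nat -> bool)) n := if odd n then x.1 n./2 else x.2 n./2.
apply: (@card_le_inj _ _ _ _ g) => // -[a b] [c d] _ _ E.
congr (_, _); apply: funext => n.
  have := congr1 (fun h => h n.*2.+1) E.
  by rewrite /g /= odd_double /= uphalf_double.
have := congr1 (fun h => h n.*2) E.
by rewrite /g odd_double /= doubleK.
Qed.

Lemma card_le_bool_seq_seq :
  ([set: nat -> nat -> bool] #<= [set: nat -> bool])%card.
Proof.
pose g (x : nat -> nat -> bool) n :=
  if unpickle n is Some p then x (p : nat * nat).1 p.2 else false.
apply: (@card_le_inj _ _ _ _ g) => // a b _ _ E.
apply: funext => n; apply: funext => m.
by have := congr1 (fun h => h (pickle (n, m))) E; rewrite /g pickleK.
Qed.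

Lemma card_le_nat_bool_seq : ([set: nat] #<= [set: nat -> bool])%card.
Proof.
apply: (@card_le_inj _ _ _ _ (fun n m => m == n)) => // n m _ _ E.
by have := congr1 (fun h => h n) E; rewrite eqxx => /esym /eqP.
Qed.
(** * Hamel bases *)

Section LinearAlgebra.
Context {K : numFieldType} {V : lmodType K}.
Implicit Types (B D W : set V) (s : seq V).

Lemma lincombE (c : V -> K) s : lincomb (map c s) s = \sum_(v <- s) c v *: v.
Proof.
rewrite /lincomb (big_nth 0) big_mkord; apply: eq_bigr => i _.
by rewrite (nth_map 0).
Qed.

(** Coefficients attached to vectors rather than to positions survive permuting the list and
    removing elements from it. *)
Lemma lin_indepP B :
  lin_indep B <-> forall s (c : V -> K), uniq s -> (forall v, v \in s -> B v) ->
    \sum_(v <- s) c v *: v = 0 -> forall v, v \in s -> c v = 0.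
Proof.
split=> [h s c us sB s0 v vs|h s c us szc sB s0 i ilt].
  have := h s (map c s) us (size_map _ _) sB.
  rewrite lincombE => /(_ s0 (index v s)); rewrite index_mem => /(_ vs).
  by rewrite (nth_map 0) ?index_mem // nth_index.
have cE : c = map (fun v => c`_(index v s)) s.
  apply: (@eq_from_nth _ 0) => [|j jc]; first by rewrite size_map.
  by rewrite (nth_map 0) -?szc // index_uniq -?szc.
have := h s (fun v => c`_(index v s)) us sB.
rewrite -lincombE -cE => /(_ s0 s`_i (mem_nth _ ilt)).
by rewrite index_uniq.
Qed.

Lemma linear_subspace_sum W (I : Type) (r : seq I) (P : pred I) (g : I -> V) :
  linear_subspace W -> (forall i, P i -> W (g i)) -> W (\sum_(i <- r | P i) g i).
Proof.
by move=> [W0 [WD _]] Wg; exact: big_ind.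
Qed.

Lemma linear_subspaceB W u v : linear_subspace W -> W u -> W v -> W (u - v).
Proof.
by move=> [_ [WD WZ]] Wu Wv; apply: WD => //; rewrite -scaleN1r; exact: WZ.
Qed.

Lemma span_sub B W : linear_subspace W -> B `<=` W -> Defs.span B `<=` W.
Proof.
move=> hW BW w [s [c [sB [szc ->]]]].
apply: linear_subspace_sum => // i _; case: hW => _ [_]; apply.
by apply/BW/sB/mem_nth.
Qed.

Lemma span_linear B : linear_subspace (Defs.span B).
Proof.
split; last split.
- by exists [::], [::]; split=> //; split=> //; rewrite /lincomb big_ord0.
- move=> _ _ [s [c [sB [szc ->]]]] [t [d [tB [szd ->]]]].
  exists (s ++ t), (c ++ d); split=> [v|].
    by rewrite mem_cat => /orP[/sB|/tB].
  split; first by rewrite !size_cat szc szd.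
  rewrite /lincomb size_cat big_split_ord /=; congr (_ + _); apply: eq_bigr => i _.
    by rewrite !nth_cat szc ltn_ord.
  by rewrite !nth_cat szc ltnNge leq_addr /= addKn.
- move=> a _ [s [c [sB [szc ->]]]].
  exists s, (map ( *%R a) c); split=> //; split; first by rewrite size_map.
  rewrite /lincomb scaler_sumr; apply: eq_bigr => i _.
  by rewrite (nth_map 0) ?szc // scalerA.
Qed.

Lemma sub_span B : B `<=` Defs.span B.
Proof.
move=> v Bv; exists [:: v], [:: 1]; split; first by move=> u; rewrite inE => /eqP ->.
by split=> //; rewrite /lincomb big_ord1 /= scale1r.
Qed.

(** In a relation over the larger set, a nonzero coefficient of [w] would put [w] into the span of
    [B]. *)
Lemma lin_indep_setU1 B w : lin_indep B -> ~ Defs.span B w -> lin_indep (B `|` [set w]).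
Proof.
move=> /lin_indepP iB nw; apply/lin_indepP => s c us sB s0 v vs.
have sBw u : u \in s -> u != w -> B u.
  by move=> us' uw; case: (sB _ us') => // /eqP; rewrite (negbTE uw).
have [ws|ws] := boolP (w \in s); last first.
  apply: (iB s c us _ s0 v vs) => u us2; apply: (sBw u us2).
  by apply: contraNN ws => /eqP <-.
have us' := perm_uniq (perm_to_rem ws); rewrite us /= in us'.
have /andP[wr ur] := esym us'.
have rB u : u \in rem w s -> B u.
  move=> ur'; apply: sBw; first exact: mem_rem ur'.
  by apply: contraNN wr => /eqP uw; rewrite -{1}uw.
move: s0; rewrite (perm_big _ (perm_to_rem ws)) big_cons /= => s0.
have cw : c w = 0.
  apply: contrapT => /eqP cw0; apply: nw.
  have -> : w = - (c w)^-1 *: \sum_(j <- rem w s) c j *: j.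
    have /eqP := s0; rewrite addrC addr_eq0 => /eqP ->.
    by rewrite scalerN scaleNr opprK scalerA mulVf // scale1r.
  case: (span_linear B) => _ [_]; apply.
  rewrite big_seq_cond; apply: linear_subspace_sum; first exact: span_linear.
  by move=> u /andP[/rB Bu _]; case: (span_linear B) => _ [_]; apply; exact: sub_span.
move: s0; rewrite cw scale0r add0r => s0.
have [->//|vw] := eqVneq v w.
apply: (iB (rem w s) c ur rB s0).
by move: vs; rewrite (perm_mem (perm_to_rem ws)) inE (negbTE vw).
Qed.

(** A relation involves finitely many vectors, and these lie in a single member of the chain. *)
Lemma lin_indep_chain (C : set (set V)) : total_on C subset ->
  (forall B, C B -> lin_indep B) -> lin_indep (\bigcup_(B in C) B).
Proof.
move=> tC iC; apply/lin_indepP => s c us sB.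
have [->//|s0] := eqVneq s [::].
have {s0} [B CB sB'] : exists2 B, C B & forall v, v \in s -> B v.
  elim: s s0 sB {us} => // v s IH _ sB.
  have [B CB Bv] := sB v (mem_head _ _).
  have [s0|s0] := eqVneq s [::].
    by exists B => // u; rewrite s0 inE => /eqP ->.
  have [|B' CB' sB'] := IH s0; first by move=> u us; apply: sB; rewrite inE us orbT.
  have [h|h] := tC _ _ CB CB'.
    by exists B' => // u; rewrite inE => /orP[/eqP ->|/sB']//; exact: h.
  by exists B => // u; rewrite inE => /orP[/eqP ->|/sB' /h].
by move=> s0; have /lin_indepP := iC _ CB; apply.
Qed.

Lemma hamel_basis_extension D W : linear_subspace W -> D `<=` W -> lin_indep D ->
  exists B, [/\ D `<=` B, B `<=` W, lin_indep B & W = Defs.span B].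
Proof.
move=> hW DW iD.
(* Independence is required of [D] together with [B], instead of requiring that [B] contain [D], so
   that the empty union of the empty chain also satisfies [P]. *)
pose P B := B `<=` W /\ lin_indep (D `|` B).
have [C CP tC|B [[BW iB] Bmax]] := @Zorn_bigcup V P.
  split; first by move=> v [B /CP[BW _]]; exact: BW.
  have [C0|/set0P[B0 CB0]] := eqVneq C set0.
    by rewrite C0 bigcup_set0 setU0.
  have -> : D `|` \bigcup_(B in C) B = \bigcup_(B in (fun B => D `|` B) @` C) B.
    rewrite bigcup_image; apply/seteqP; split=> v.
      by move=> [Dv|[B CB Bv]]; [exists B0 => //; left|exists B => //; right].
    by move=> [B CB [Dv|Bv]]; [left|right; exists B].
  apply: lin_indep_chain => [_ _ [B1 C1 <-] [B2 C2 <-]|_ [B CB <-]].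
    by have [h|h] := tC _ _ C1 C2; [left|right]; apply: setUS.
  by have [] := CP _ CB.
exists (D `|` B); split=> //.
- by move=> v [/DW|/BW].
have sW : D `|` B `<=` W by move=> v [/DW|/BW].
apply/seteqP; split; last exact: span_sub.
move=> w Ww; apply: contrapT => nw.
apply: (Bmax (B `|` [set w])).
  split; first by move=> v Bv; left.
  move=> /(_ w (or_intror erefl)) Bw; apply: nw.
  by apply: sub_span; right.
split; first by move=> v [/BW//|->].
by rewrite setUA; exact: lin_indep_setU1.
Qed.

(** A Hamel basis of [W] extending [D] lies between [D] and [W], which squeezes its cardinality. *)
Lemma hamel_dim_eqW (T : Type) (S : set T) D W : linear_subspace W -> D `<=` W ->
  lin_indep D -> (S #<= D)%card -> (W #<= S)%card -> hamel_dim_eq W S.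
Proof.
move=> hW DW iD SD WS; have [B [DB BW iB ->]] := hamel_basis_extension hW DW iD.
exists B; split; first exact: sub_span.
split=> //; split=> //; apply/card_eqPle; split.
  by apply: card_le_trans WS; exact: subset_card_le.
by apply: card_le_trans SD _; exact: subset_card_le.
Qed.

End LinearAlgebra.
(** * Complete quasi-normed spaces *)

(** The norm of [K] has its values in [K], whereas the estimates below are made in [R]; hence an
    absolute value with real values. The field [abs_small] provides the nonzero scalars for the
    rescaling. *)
Record complete_abs_value {R : realType} {K : numFieldType} (absK : K -> R) : Prop := {
  abs_ge0 : forall a, 0 <= absK a;
  abs0 : absK 0 = 0;
  abs1 : absK 1 = 1;
  abs_eq0 : forall a, absK a = 0 -> a = 0;
  absM : forall a b, absK (a * b) = absK a * absK b;
  abs_small : forall e, 0 < e -> exists2 a, a != 0 & absK a < e;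
  abs_complete : forall u : nat -> K,
    (forall e, 0 < e -> exists N, forall m n, (N <= m)%N -> (N <= n)%N ->
       absK (u m - u n) < e) ->
    exists l, forall e, 0 < e -> exists N, forall n, (N <= n)%N -> absK (u n - l) < e }.

Record complete_quasi_norm {R : realType} {K : numFieldType} {V : lmodType K}
    (absK : K -> R) (E : set V) (q : V -> R) (C : R) : Prop := {
  qn_space : linear_subspace E;
  qn_ge0 : forall v, E v -> 0 <= q v;
  qn_eq0 : forall v, E v -> q v = 0 -> v = 0;
  qnZ : forall a v, E v -> q (a *: v) = absK a * q v;
  qn_modulus : 1 <= C;
  qnD : forall u v, E u -> E v -> q (u + v) <= C * (q u + q v);
  qn_complete : forall u : nat -> V, (forall n, E (u n)) ->
    (forall e, 0 < e -> exists N, forall m n, (N <= m)%N -> (N <= n)%N ->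
       q (u m - u n) < e) ->
    exists v, E v /\ forall e, 0 < e -> exists N, forall n, (N <= n)%N -> q (u n - v) < e }.

Lemma invS_lt_eventually {R : realType} (e : R) : 0 < e ->
  exists N, forall n, (N <= n)%N -> n.+1%:R^-1 < e.
Proof.
move=> e0; exists (Num.truncn e^-1) => n Nn.
rewrite -[e]invrK ltf_pV2 ?posrE ?invr_gt0 ?ltr0n //.
apply: (lt_le_trans (truncnS_gt _)).
by rewrite ler_nat ltnS.
Qed.

Definition line_ext {K : numFieldType} {V : lmodType K} (W : set V) (x : V) : set V :=
  [set v | exists a : K, W (v - a *: x)].

Definition fin_span {K : numFieldType} {V : lmodType K} (e : nat -> V) (n : nat) : set V :=
  [set v | exists c : nat -> K, v = \sum_(i < n) c i *: e i].

Definition seq_span {K : numFieldType} {V : lmodType K} (e : nat -> V) : set V :=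
  [set v | exists n, fin_span e n v].

Section FinSpan.
Context {K : numFieldType} {V : lmodType K}.
Implicit Types (W : set V) (e : nat -> V).

Lemma sub_line_ext W x : W `<=` line_ext W x.
Proof. by move=> v Wv; exists 0; rewrite scale0r subr0. Qed.

Lemma line_ext_gen W x : linear_subspace W -> line_ext W x x.
Proof. by move=> [W0 _]; exists 1; rewrite scale1r subrr. Qed.

Lemma line_ext_linear W x : linear_subspace W -> linear_subspace (line_ext W x).
Proof.
move=> hW; have [W0 [WD WZ]] := hW; split; last split.
- exact: sub_line_ext.
- move=> u v [a Wa] [b Wb]; exists (a + b).
  by rewrite scalerDl opprD addrACA; exact: WD.
- by move=> a u [b Wb]; exists (a * b); rewrite -scalerA -scalerBr; exact: WZ.
Qed.

Lemma fin_span0 e : fin_span e 0 = [set 0].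
Proof.
apply/seteqP; split=> v; first by move=> [c ->]; rewrite big_ord0.
by move=> ->; exists (fun=> 0); rewrite big_ord0.
Qed.

Lemma fin_spanS e n : fin_span e n.+1 = line_ext (fin_span e n) (e n).
Proof.
apply/seteqP; split=> v.
  by move=> [c ->]; exists (c n), c; rewrite big_ord_recr /= addrK.
move=> [a [c h]]; exists (fun i => if i == n then a else c i).
rewrite big_ord_recr /= eqxx -[v](subrK (a *: e n)) h; congr (_ + _).
by apply: eq_bigr => i _; rewrite ltn_eqF.
Qed.

Lemma fin_span_linear e n : linear_subspace (fin_span e n).
Proof.
elim: n => [|n IH]; last by rewrite fin_spanS; exact: line_ext_linear.
rewrite fin_span0; split=> //; split=> [u v -> ->|a u ->]; first exact: addr0.
exact: scaler0.
Qed.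

Lemma fin_span_sub e n E : linear_subspace E -> (forall i, (i < n)%N -> E (e i)) ->
  fin_span e n `<=` E.
Proof.
move=> hE Ee _ [c ->]; apply: linear_subspace_sum => // i _.
by case: hE => _ [_]; apply; exact: Ee.
Qed.

Lemma fin_span_incr e m n : (m <= n)%N -> fin_span e m `<=` fin_span e n.
Proof.
move=> /subnKC <-; elim: (n - m)%N => [|k IH]; first by rewrite addn0.
by rewrite addnS fin_spanS; apply: subset_trans IH _; exact: sub_line_ext.
Qed.

Lemma seq_span_linear e : linear_subspace (seq_span e).
Proof.
split; last split.
- by exists 0%N; rewrite fin_span0.
- move=> u v [m um] [n vn]; exists (maxn m n).
  have [_ [D _]] := fin_span_linear e (maxn m n); apply: D.
    by apply: fin_span_incr um; exact: leq_maxl.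
  by apply: fin_span_incr vn; exact: leq_maxr.
- move=> a u [m um]; exists m.
  by have [_ [_ Z]] := fin_span_linear e m; exact: Z.
Qed.

Lemma seq_span_sub e E : linear_subspace E -> (forall n, E (e n)) -> seq_span e `<=` E.
Proof. by move=> hE Ee v [n]; apply: fin_span_sub => // i _; exact: Ee. Qed.

Lemma seq_span_gen e n : seq_span e (e n).
Proof. by exists n.+1; rewrite fin_spanS; apply: line_ext_gen; exact: fin_span_linear. Qed.

End FinSpan.

(** The closure of [W] in [E], stated by approximation since [V] carries no topology here. *)
Definition qcl {R : realType} {V : zmodType} (E : set V) (q : V -> R) (W : set V) : set V :=
  [set x | E x /\ forall e, 0 < e -> exists w, W w /\ q (x - w) < e].

Section QuasiNorm.
Context {R : realType} {K : numFieldType} {V : lmodType K}.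
Variables (absK : K -> R) (E : set V) (q : V -> R) (C : R).
Hypothesis habs : complete_abs_value absK.
Hypothesis hq : complete_quasi_norm absK E q C.
Implicit Types (W : set V) (u v w x z : V).

Let hE : linear_subspace E := qn_space hq.
Let E0 : E 0. Proof. by case: hE. Qed.
Let ED u v : E u -> E v -> E (u + v). Proof. by case: hE => _ [D _]; exact: D. Qed.
Let EZ a u : E u -> E (a *: u). Proof. by case: hE => _ [_ Z]; exact: Z. Qed.
Let EB u v : E u -> E v -> E (u - v). Proof. exact: linear_subspaceB. Qed.
Let C1 : 1 <= C := qn_modulus hq.
Let C0 : 0 < C. Proof. exact: lt_le_trans C1. Qed.

Lemma absN a : absK (- a) = absK a.
Proof.
rewrite -mulN1r (absM habs).
have : absK (-1) * absK (-1) = 1 by rewrite -(absM habs) mulrNN mulr1 (abs1 habs).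
have := abs_ge0 habs (-1); move: (absK (-1)) => t t0 tt.
by have -> : t = 1; [nra|rewrite mul1r].
Qed.

Lemma abs_gt0 a : a != 0 -> 0 < absK a.
Proof.
move=> a0; rewrite lt0r (abs_ge0 habs) andbT.
by apply: contra a0 => /eqP /(abs_eq0 habs) ->.
Qed.

Lemma qnN v : E v -> q (- v) = q v.
Proof.
by move=> Ev; rewrite -scaleN1r (qnZ hq) // absN (abs1 habs) mul1r.
Qed.

Lemma qn0 : q 0 = 0.
Proof. by rewrite -(scale0r 0) (qnZ hq) // (abs0 habs) mul0r. Qed.

Lemma qnBC u v : E u -> E v -> q (u - v) = q (v - u).
Proof. by move=> Eu Ev; rewrite -opprB qnN //; exact: EB. Qed.

(** Because of the modulus [C], an error [e] is shared out in parts [e / (2 * C)] instead of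
    halves. *)
Lemma qnD_lt (e : R) u v : E u -> E v -> q u < e / (2 * C) -> q v < e / (2 * C) ->
  q (u + v) < e.
Proof.
move=> Eu Ev; rewrite !ltr_pdivlMr ?mulr_gt0 // => qu qv.
by apply: le_lt_trans (qnD hq Eu Ev) _; lra.
Qed.

Let half_gt0 (e : R) : 0 < e -> 0 < e / (2 * C).
Proof. by move=> e0; rewrite divr_gt0 // mulr_gt0. Qed.

Lemma sub_qcl W : W `<=` E -> W `<=` qcl E q W.
Proof.
move=> WE w Ww; split; first exact: WE.
by move=> e e0; exists w; rewrite subrr qn0.
Qed.

Lemma qcl_mono W1 W2 : W1 `<=` W2 -> qcl E q W1 `<=` qcl E q W2.
Proof. by move=> h v [Ev a]; split=> // e /a[w [/h Ww ?]]; exists w. Qed.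

Lemma qcl_idem W : W `<=` E -> qcl E q (qcl E q W) `<=` qcl E q W.
Proof.
move=> WE x [Ex ax]; split=> // e e0.
have [v [[Ev av] xv]] := ax _ (half_gt0 e0).
have [w [Ww vw]] := av _ (half_gt0 e0); exists w; split=> //.
rewrite -[x](subrK v) -addrA; apply: qnD_lt => //; first exact: EB.
by apply: EB => //; exact: WE.
Qed.

Lemma qcl_linear W : linear_subspace W -> W `<=` E -> linear_subspace (qcl E q W).
Proof.
move=> [W0 [WD WZ]] WE; split; last split.
- exact: sub_qcl.
- move=> u v [Eu au] [Ev av]; split; first exact: ED.
  move=> e e0; have [u' [Wu uu]] := au _ (half_gt0 e0).
  have [v' [Wv vv]] := av _ (half_gt0 e0); exists (u' + v'); split; first exact: WD.
  by rewrite opprD addrACA; apply: qnD_lt => //; apply: EB => //; exact: WE.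
- move=> a u [Eu au]; split; first exact: EZ.
  move=> e e0; have a1 : 0 < absK a + 1 by have := abs_ge0 habs a; lra.
  have [w [Ww]] := au (e / (absK a + 1)) (divr_gt0 e0 a1).
  rewrite ltr_pdivlMr // => uw; exists (a *: w); split; first exact: WZ.
  have EW := WE _ Ww.
  rewrite -scalerBr (qnZ hq); last exact: EB.
  by have := qn_ge0 hq (EB Eu EW); have := abs_ge0 habs a; nra.
Qed.

Lemma dist_gt0 W x : qcl E q W `<=` W -> E x -> ~ W x ->
  exists2 d : R, 0 < d & forall w, W w -> d <= q (x - w).
Proof.
move=> clW Ex nWx; apply: contrapT => h; apply/nWx/clW; split=> // e e0.
apply: contrapT => nw; apply: h; exists e => // w Ww.
by rewrite leNgt; apply/negP => ?; apply: nw; exists w.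
Qed.

(** By homogeneity, the distance from [x] to [W] controls the coefficient of [x] by the size of the
    whole vector. *)
Lemma dist_scale W x (d : R) : linear_subspace W -> W `<=` E -> E x ->
  (forall w, W w -> d <= q (x - w)) ->
  forall a w, W w -> absK a * d <= q (a *: x + w).
Proof.
move=> [W0 [WD WZ]] WE Ex hd a w Ww.
have [->|a0] := eqVneq a 0.
  by rewrite (abs0 habs) mul0r; apply: (qn_ge0 hq); apply: ED; [exact: EZ|exact: WE].
have -> : a *: x + w = a *: (x - (- a^-1 *: w)).
  by rewrite scaleNr opprK scalerDr scalerA divff // scale1r.
have Ww' := WZ (- a^-1) _ Ww.
rewrite (qnZ hq); last by apply: EB => //; exact: WE.
by apply: ler_wpM2l; [exact: (abs_ge0 habs)|exact: hd].
Qed.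

(** If [x] is outside [W], its distance to [W] is positive, so the coefficients of [x] in
    approximants of [z] form a Cauchy sequence. With [l] their limit, [z - l *: x] is a limit of
    elements of [W]. *)
Lemma line_ext_closed W x : linear_subspace W -> W `<=` E -> qcl E q W `<=` W -> E x ->
  qcl E q (line_ext W x) `<=` line_ext W x.
Proof.
move=> hW WE clW Ex z; have [W0 [WD WZ]] := hW.
have [Wx|nWx] := pselect (W x).
  move=> hz; apply/sub_line_ext/clW; apply: qcl_mono hz => v [a h].
  by rewrite -[v](subrK (a *: x)); apply: WD => //; exact: WZ.
move=> [Ez az]; have [d d0 hd] := dist_gt0 clW Ex nWx.
have /choice[p hp] n : exists p : K * V,
    W (p.2 - p.1 *: x) /\ q (z - p.2) < n.+1%:R^-1.
  have [|v [[a h] qv]] := az (n.+1%:R^-1); first by rewrite invr_gt0 ltr0n.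
  by exists (a, v).
have Ep n : E (p n).2.
  rewrite -[(p n).2](subrK ((p n).1 *: x)); apply: ED; last exact: EZ.
  by apply: WE; case: (hp n).
have [|l hl] := abs_complete habs (u := fun n => (p n).1).
  (* Approximants within [e * d] of each other have coefficients within [e], by [dist_scale]. *)
  move=> e e0; have [N hN] := invS_lt_eventually (half_gt0 (mulr_gt0 e0 d0)).
  exists N => m n Nm Nn; rewrite -(ltr_pM2r d0).
  have h := linear_subspaceB hW (proj1 (hp m)) (proj1 (hp n)).
  apply: le_lt_trans (dist_scale hW WE Ex hd _ h) _.
  have -> : ((p m).1 - (p n).1) *: x +
      ((p m).2 - (p m).1 *: x - ((p n).2 - (p n).1 *: x)) =
      ((p m).2 - z) + (z - (p n).2).
    rewrite [RHS]addrA subrK opprB scalerBl addrA [_ - _ + (_ - _)]addrC !addrA.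
    by rewrite !subrK.
  apply: qnD_lt; [exact: EB|exact: EB| |].
    rewrite qnBC //; apply: lt_trans (proj2 (hp m)) _; exact: hN.
  by apply: lt_trans (proj2 (hp n)) _; exact: hN.
exists l; apply: clW; split; first by apply: EB => //; exact: EZ.
move=> e e0.
have qx1 : 0 < q x + 1 by have := qn_ge0 hq Ex; lra.
have [N1 hN1] := invS_lt_eventually (half_gt0 e0).
have [N2 hN2] := hl _ (divr_gt0 (half_gt0 e0) qx1).
pose n := maxn N1 N2; exists ((p n).2 - (p n).1 *: x); split; first by case: (hp n).
have -> : z - l *: x - ((p n).2 - (p n).1 *: x) =
    (z - (p n).2) + ((p n).1 - l) *: x.
  by rewrite opprB scalerBl addrACA [RHS]addrACA; congr (_ + _); exact: addrC.
apply: qnD_lt; [exact: EB|exact: EZ| |].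
  by apply: lt_trans (proj2 (hp n)) _; apply: hN1; exact: leq_maxl.
have := hN2 n (leq_maxr _ _); rewrite ltr_pdivlMr // (qnZ hq) //.
by have := qn_ge0 hq Ex; have := abs_ge0 habs ((p n).1 - l); nra.
Qed.

(** The right-hand side contains the extended space and is itself closed. *)
Lemma qcl_line_ext W x : linear_subspace W -> W `<=` E -> E x ->
  qcl E q (line_ext W x) `<=` line_ext (qcl E q W) x.
Proof.
move=> hW WE Ex; apply: subset_trans (line_ext_closed _ _ _ Ex).
- by apply: qcl_mono => v [a h]; exists a; exact: sub_qcl.
- exact: qcl_linear.
- by move=> v [].
- exact: qcl_idem.
Qed.

Lemma fin_span_closed (e : nat -> V) n : (forall n, E (e n)) ->
  qcl E q (fin_span e n) `<=` fin_span e n.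
Proof.
move=> Ee; elim: n => [|n IH]; last first.
  rewrite fin_spanS; apply: line_ext_closed => //; first exact: fin_span_linear.
  by apply: fin_span_sub => // i _; exact: Ee.
rewrite fin_span0 => v [Ev av]; apply: (qn_eq0 hq Ev).
apply/eqP; rewrite eq_le (qn_ge0 hq) // andbT leNgt; apply/negP => qv.
by have [w [->]] := av _ qv; rewrite subr0 ltxx.
Qed.

(** A point of the closure is determined by a sequence of finite combinations converging to it, and
    there are at most as many such sequences as binary sequences. *)
Lemma card_qcl_seq_span (e : nat -> V) : (forall n, E (e n)) ->
  ([set: K] #<= [set: nat -> bool])%card ->
  (qcl E q (seq_span e) #<= [set: nat -> bool])%card.
Proof.
move=> Ee cK.
(* [P w n] holds the length and the coefficients of a combination within [1 / (n + 1)] of [w];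
   outside the closure its value is arbitrary. *)
have /choice[P hP] w : exists P : nat -> nat * (nat -> K), qcl E q (seq_span e) w ->
    forall n, q (w - \sum_(i < (P n).1) (P n).2 i *: e i) < n.+1%:R^-1.
  have [[Ew aw]|nw] := pselect (qcl E q (seq_span e) w); last by exists (fun=> (0%N, fun=> 0)).
  have /choice[P hP] n : exists p : nat * (nat -> K),
      q (w - \sum_(i < p.1) p.2 i *: e i) < n.+1%:R^-1.
    have [|_ [[m [c ->]] h]] := aw (n.+1%:R^-1); first by rewrite invr_gt0 ltr0n.
    by exists (m, c).
  by exists P.
apply: (@card_le_trans _ _ _ [set: nat -> nat * (nat -> K)]).
  apply: (@card_le_inj _ _ _ _ P) => // x y hx hy Pxy.
  have [Ex _] := hx; have [Ey _] := hy.
  apply/eqP; rewrite -subr_eq0; apply/eqP/(qn_eq0 hq (EB Ex Ey))/eqP.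
  rewrite eq_le (qn_ge0 hq (EB Ex Ey)) andbT leNgt; apply/negP => h.
  (* With [q (x - y)] itself as precision, the approximant [z] common to [x] and [y] yields
     [q (x - y) < q (x - y)]. *)
  have [N hN] := invS_lt_eventually (half_gt0 h).
  have Ez : E (\sum_(i < (P x N).1) (P x N).2 i *: e i).
    by apply: linear_subspace_sum => // i _; exact: EZ.
  set z := (X in E X) in Ez.
  have: q ((x - z) + (z - y)) < q (x - y); last by rewrite addrA subrK ltxx.
  apply: qnD_lt; [exact: EB|exact: EB| |].
    by apply: lt_trans (hP _ hx N) _; exact: hN.
  rewrite (qnBC Ez Ey) /z Pxy; apply: lt_trans (hP _ hy N) _; exact: hN.
have cKs : ([set: nat * (nat -> K)] #<= [set: nat -> bool])%card.
  apply: card_le_trans card_le_bool_seq_prod.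
  apply: card_le_prod; first exact: card_le_nat_bool_seq.
  by apply: card_le_trans card_le_bool_seq_seq; exact: card_le_fun.
by apply: card_le_trans card_le_bool_seq_seq; exact: card_le_fun.
Qed.

(* The weights [r] bound the tails of every series [\sum c_i s_i e_i] with bounded
   coefficients, while each term beats its own tail modulo the preceding [e_i] by a
   factor that tends to infinity. *)
Record rescaling (e : nat -> V) (s : nat -> K) (r : nat -> R) : Prop := {
  rsc_gt0 : forall n, 0 < r n;
  rsc_lt : forall n, r n * n.+1%:R <= 1;
  rsc_term : forall n, C * (q (s n *: e n) + r n.+1) <= r n;
  rsc_dist : forall n a w, fin_span e n w ->
    absK a * (r n.+1 * n.+1%:R) <= q ((a * s n) *: e n + w) }.

Lemma ex_rescaling (e : nat -> V) : (forall n, E (e n)) ->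
  (forall n, ~ fin_span e n (e n)) -> exists s r, rescaling e s r.
Proof.
move=> Ee ef.
have /choice[d hd] n : exists d : R, 0 < d /\ forall w, fin_span e n w -> d <= q (e n - w).
  by have [d d0 hd] := dist_gt0 (@fin_span_closed e n Ee) (Ee n) (ef n); exists d.
(* [g (n, t)] will be the scalar [s n] once [r n = t] is known: it makes the [n]-th term use at most
   half of [r n]. *)
have /choice[g hg] (p : nat * R) : exists a : K, 0 < p.2 ->
    a != 0 /\ C * (absK a * q (e p.1)) <= p.2 / 2.
  have [p0|p0] := ltP 0 p.2; last by exists 0.
  have qe := qn_ge0 hq (Ee p.1).
  have Cq : 0 < 2 * C * (q (e p.1) + 1) by rewrite mulr_gt0 ?mulr_gt0 //; lra.
  have [a a0] := abs_small habs (divr_gt0 p0 Cq).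
  rewrite ltr_pdivlMr // => ha; exists a => _; split=> //.
  have : 0 <= absK a * C by rewrite mulr_ge0 ?(abs_ge0 habs) // ltW.
  by lra.
(* The first bound leaves the other half of [r n] to the tail and makes [r] at least halve, whence
   [rsc_lt]. The second is the distance of [s n *: e n] to its predecessors divided by [n + 1],
   whence [rsc_dist]. *)
pose step n t := Num.min (t / (2 * C)) (absK (g (n, t)) * d n / n.+1%:R).
pose r n := iteri n step 1; pose s n := g (n, r n).
have rS n : r n.+1 = Num.min (r n / (2 * C)) (absK (s n) * d n / n.+1%:R) by [].
have r0 n : 0 < r n.
  elim: n => [|n IH]; first exact: ltr01.
  rewrite rS lt_min half_gt0 // divr_gt0 ?ltr0n // mulr_gt0 ?(proj1 (hd n)) //.
  by apply: abs_gt0; have [] := hg (n, r n) IH.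
have rS2 n : 2 * C * r n.+1 <= r n.
  by rewrite mulrC -ler_pdivlMr ?mulr_gt0 // rS ge_min lexx.
exists s, r; split=> //.
- elim=> [|n IH]; first by rewrite mulr1.
  apply: le_trans IH.
  have h : r n.+1 * 2 <= r n.
    by apply: le_trans (rS2 n); have := r0 n.+1; have := C1; nra.
  rewrite -(natr1 n.+1); have := r0 n.+1.
  have : 1 <= n.+1%:R :> R by rewrite ler1n.
  by move: (n.+1%:R : R) => t; nra.
- move=> n; rewrite (qnZ hq) //.
  by have [_] := hg (n, r n) (r0 n); have := rS2 n; rewrite /= -/(s n); lra.
- move=> n a w ws.
  apply: le_trans (dist_scale (fin_span_linear e n) (fin_span_sub hE (fun i _ => Ee i)) (Ee n)
    (proj2 (hd n)) (a * s n) ws).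
  rewrite (absM habs) -mulrA; apply: ler_wpM2l; first exact: (abs_ge0 habs).
  by rewrite -ler_pdivlMr ?ltr0n // rS ge_min lexx orbT.
Qed.

(** * Series in the rescaled vectors *)

Section Series.
Variables (e : nat -> V) (s : nat -> K) (r : nat -> R).
Hypotheses (Ee : forall n, E (e n)) (hr : rescaling e s r).
Implicit Types c : nat -> K.

Let psum c N := \sum_(i < N) (c i * s i) *: e i.

Let psumE c N : E (psum c N).
Proof. by apply: linear_subspace_sum => // i _; exact: EZ. Qed.

Let psumS c N : psum c N.+1 = psum c N + (c N * s N) *: e N.
Proof. by rewrite /psum big_ord_recr. Qed.

(** Convergence of the series to [v] at the rate [r]. The rate is kept under linear combinations,
    and it is what allows a coefficient to be compared with the remainder after it. *)
Definition sums_to c v := E v /\ exists M, forall N, q (v - psum c N) <= M * r N.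

(** The induction splits off the first term and not the last one: [rsc_term] then absorbs the factor
    [C] of the quasi-triangle inequality at each step. *)
Let psum_tail c N k : (forall n, absK (c n) <= 1) ->
  q (psum c (N + k) - psum c N) <= r N.
Proof.
move=> c1; elim: k N => [|k IH] N.
  by rewrite addn0 subrr qn0 ltW // (rsc_gt0 hr).
have -> : psum c (N + k.+1) - psum c N =
    (c N * s N) *: e N + (psum c (N.+1 + k) - psum c N.+1).
  by rewrite addSnnS psumS opprD [RHS]addrC !addrA subrK.
apply: le_trans (rsc_term hr N); apply: le_trans (qnD hq _ _) _; [exact: EZ|exact: EB|].
rewrite ler_pM2l // lerD // -scalerA (qnZ hq); last exact: EZ.
by rewrite ler_piMl // (qn_ge0 hq) //; exact: EZ.
Qed.

Lemma sums_to_exists c : (forall n, absK (c n) <= 1) -> exists v, sums_to c v.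
Proof.
move=> c1.
have tail N n : (N <= n)%N -> q (psum c n - psum c N) <= r N.
  by move=> /subnKC <-; exact: psum_tail.
have rsmall (d : R) : 0 < d -> exists N, r N < d.
  move=> d0; have [N hN] := invS_lt_eventually d0; exists N.
  apply: le_lt_trans (hN N _) => //.
  by rewrite -[leRHS]mul1r ler_pdivlMr ?ltr0n // (rsc_lt hr).
have [|v [Ev hv]] := qn_complete hq (psumE c).
  move=> d d0; have [N hN] := rsmall _ (half_gt0 d0).
  exists N => m n Nm Nn; rewrite -(subrK (psum c N) (psum c m)) -addrA.
  apply: qnD_lt; [exact: EB|exact: EB| |].
    exact: le_lt_trans (tail _ _ Nm) hN.
  by rewrite qnBC //; exact: le_lt_trans (tail _ _ Nn) hN.
(* A late partial sum is within [r N] of both [v] and the [N]-th partial sum; the quasi-triangle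
   inequality then gives [C * (r N + r N)]. *)
exists v; split=> //; exists (2 * C) => N.
have [N' hN'] := hv _ (rsc_gt0 hr N).
have := hN' _ (leq_maxl N' N); have := tail _ _ (leq_maxr N' N).
set n := maxn N' N; rewrite qnBC // => h1 h2.
have -> : v - psum c N = (v - psum c n) + (psum c n - psum c N) by rewrite addrA subrK.
apply: le_trans (qnD hq (EB Ev (psumE c n)) (EB (psumE c n) (psumE c N))) _.
by rewrite [2 * C]mulrC -mulrA ler_pM2l // qnBC // [q (psum c n - _)]qnBC //; lra.
Qed.

Lemma sums_to0 : sums_to (fun=> 0) 0.
Proof.
split=> //; exists 0 => N; rewrite mul0r /psum big1 ?subr0 ?qn0 // => i _.
by rewrite mul0r scale0r.
Qed.

Lemma sums_to_linear a c v c' v' : sums_to c v -> sums_to c' v' ->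
  sums_to (fun n => a * c n + c' n) (a *: v + v').
Proof.
move=> [Ev [M hM]] [Ev' [M' hM']]; split; first by apply: ED => //; exact: EZ.
exists (C * (absK a * M + M')) => N.
have -> : psum (fun n => a * c n + c' n) N = a *: psum c N + psum c' N.
  rewrite /psum scaler_sumr -big_split; apply: eq_bigr => i _.
  by rewrite mulrDl scalerDl scalerA mulrA.
rewrite opprD addrACA -scalerBr; apply: le_trans (qnD hq _ _) _.
- by apply/EZ/EB.
- exact: EB.
- rewrite -mulrA ler_pM2l // mulrDl lerD // (qnZ hq); last exact: EB.
  by rewrite -mulrA ler_wpM2l // (abs_ge0 habs).
Qed.

Lemma sums_to_qcl c v : sums_to c v -> qcl E q (seq_span e) v.
Proof.
move=> [Ev [M hM]]; split=> // d d0.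
have M0 : 0 <= M.
  rewrite -(pmulr_lge0 _ (rsc_gt0 hr 0)); apply: le_trans (hM 0%N).
  by apply: (qn_ge0 hq); exact: EB.
have [N hN] := invS_lt_eventually (divr_gt0 d0 (ltr_wpDl M0 ltr01)).
exists (psum c N); split; first by exists N, (fun i => c i * s i).
apply: le_lt_trans (hM N) _; have := hN N (leqnn N).
rewrite ltr_pdivlMr; last exact: ltr_wpDl.
have h : r N <= N.+1%:R^-1 by rewrite -[leRHS]mul1r ler_pdivlMr ?ltr0n // (rsc_lt hr).
have := rsc_gt0 hr N; move: (N.+1%:R^-1) h => t h r0 ht.
by apply: le_lt_trans ht; nra.
Qed.

(** If the sum is 0, the partial sum ending with the coefficient [a] at index [N] has size at most
    [M * r N.+1], but [rsc_dist] bounds it below by [|a| * r N.+1 * (N + 1)]. This is impossible for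
    nonzero [a] once [N + 1] exceeds [M / |a|]. *)
Lemma sums_to_zero_coef c a : sums_to c 0 ->
  (forall k, exists2 N, (k <= N)%N & c N = a) -> a = 0.
Proof.
move=> [_ [M hM]] ha; apply: contrapT => /eqP a0.
have [N kN cN] := ha (Num.truncn (M / absK a)).
have : M / absK a < N.+1%:R.
  by apply: lt_le_trans (truncnS_gt _) _; rewrite ler_nat ltnS.
rewrite ltr_pdivrMr; last exact: abs_gt0.
apply/negP; rewrite -leNgt.
have := hM N.+1; rewrite sub0r qnN // psumS cN addrC => h.
have hs : fin_span e N (psum c N) by exists (fun i => c i * s i).
have := le_trans (rsc_dist hr a hs) h; rewrite mulrCA mulrC ler_pM2r ?(rsc_gt0 hr) //.
by rewrite mulrC.
Qed.

End Series.
End QuasiNorm.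

(** * Almost disjoint branches of the binary tree *)

Definition branch (b : nat -> bool) (N : nat) : bool :=
  `[< exists n, N = pickle (mkseq b n) >].

Lemma mem_branch b n : branch b (pickle (mkseq b n)).
Proof. by apply/asboolP; exists n. Qed.

(** The nodes of the tree are finite words numbered by [pickle], and a branch consists of the
    numbers of the prefixes of [b]. A prefix longer than [k] shows the place [k] at which [b] and
    [b'] differ. *)
Lemma branch_almost_disjoint (b b' : nat -> bool) : b <> b' ->
  exists k, forall n, (k <= n)%N -> ~~ branch b' (pickle (mkseq b n)).
Proof.
move=> nb; have [k hk] : exists k, b k <> b' k.
  by apply: contrapT => h; apply: nb; apply: funext => k; apply: contrapT => ?; apply: h; exists k.
exists k.+1 => n kn; apply/asboolP => -[m /(pcan_inj pickleK) E].
have nm : n = m by rewrite -(size_mkseq b n) E size_mkseq.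
by apply: hk; have := congr1 (nth false ^~ k) E; rewrite !nth_mkseq // -nm.
Qed.

(** Pigeonhole: [k + 1] distinct values cannot all be below [k]. *)
Lemma injective_unbounded (g : nat -> nat) k m : injective g ->
  exists n, (m <= n)%N /\ (k <= g n)%N.
Proof.
move=> ginj; apply: contrapT => h.
have lt (i : 'I_k.+1) : (g (m + i) < k)%N.
  by rewrite ltnNge; apply/negP => hi; apply: h; exists (m + i)%N; rewrite leq_addr.
suff /leq_card : injective (fun i => Ordinal (lt i)) by rewrite !card_ord ltnn.
by move=> i j /(congr1 val) /= /ginj /addnI /val_inj.
Qed.

Lemma branch_unbounded (b : nat -> bool) (k m : nat) :
  exists n, (m <= n)%N /\ (k <= pickle (mkseq b n))%N.
Proof.
apply: (@injective_unbounded (fun n => pickle (mkseq b n))) => i j.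
by move=> /(pcan_inj pickleK) /(congr1 size); rewrite !size_mkseq.
Qed.

Lemma branch_almost_disjoint_seq (T : eqType) (b : T -> nat -> bool) (s : seq T) b0 :
  (forall t, t \in s -> b0 <> b t) ->
  exists k, forall n, (k <= n)%N -> forall t, t \in s -> ~~ branch (b t) (pickle (mkseq b0 n)).
Proof.
elim: s => [|t s IH] hs; first by exists 0%N.
have [|k hk] := IH; first by move=> u us; apply: hs; rewrite inE us orbT.
have [k' hk'] := branch_almost_disjoint (hs t (mem_head _ _)).
exists (maxn k k') => n; rewrite geq_max => /andP[kn kn'] u; rewrite inE => /orP[/eqP ->|us].
  exact: hk'.
exact: hk.
Qed.

(** * The Hamel dimension of the closed span of a sequence *)

Section HamelDimension.
Context {R : realType} {K : numFieldType} {V : lmodType K}.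
Variables (absK : K -> R) (E : set V) (q : V -> R) (C : R).
Hypothesis habs : complete_abs_value absK.
Hypothesis hq : complete_quasi_norm absK E q C.

Theorem hamel_dim_qcl_seq_span (e : nat -> V) : (forall n, E (e n)) ->
  (forall n, ~ fin_span e n (e n)) -> ([set: K] #<= [set: nat -> bool])%card ->
  hamel_dim_eq (qcl E q (seq_span e)) [set: R].
Proof.
move=> Ee ef cK.
have [s [r hr]] := ex_rescaling habs hq Ee ef.
pose ind b N : K := (branch b N)%:R.
have /choice[v hv] b : exists v, sums_to E q e s r (ind b) v.
  apply: (sums_to_exists habs hq Ee hr) => n; rewrite /ind.
  by case: branch; rewrite /= ?(abs1 habs) ?(abs0 habs).
apply: (@hamel_dim_eqW _ _ _ _ (range v)).
- by apply: (qcl_linear habs hq (seq_span_linear _)); apply: seq_span_sub => //; exact: qn_space hq.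
- by move=> _ [b _ <-]; exact: (sums_to_qcl hq Ee hr (hv b)).
- apply/lin_indepP => us c uus usv us0 u0 u0s.
  (* A branch is chosen for each vector of the relation; the constant false sequence is only a
     default value. *)
  have /choice[b hb] u : exists b, range v u -> v b = u.
    by have [[b _ <-]|nu] := pselect (range v u); [exists b|exists xpred0].
  have hb' u : u \in us -> v (b u) = u by move=> /usv /hb.
  (* A linear relation between branch sums becomes one series with sum 0. Far out on the branch of
     [u0] the other branches of the relation are absent, so the coefficient there is [c u0],
     infinitely often. *)
  have hsum : sums_to E q e s r (fun N => \sum_(u <- us) c u * ind (b u) N)
      (\sum_(u <- us) c u *: u).
    elim: us hb' {uus usv us0 u0s} => [|u us IH] hb'.
      rewrite big_nil; rewrite [X in sums_to _ _ _ _ _ X](_ : _ = fun=> 0).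
        exact: (sums_to0 habs hq e s r).
      by apply: funext => N; rewrite big_nil.
    rewrite big_cons [X in sums_to _ _ _ _ _ X](_ : _ = fun N =>
      c u * ind (b u) N + \sum_(u <- us) c u * ind (b u) N); last first.
      by apply: funext => N; rewrite big_cons.
    apply: (sums_to_linear habs hq Ee).
      by rewrite -[u in X in sums_to _ _ _ _ _ _ X]hb' ?mem_head //; exact: hv.
    by apply: IH => w ws; apply: hb'; rewrite inE ws orbT.
  rewrite us0 in hsum.
  have urem : u0 \notin rem u0 us by rewrite mem_rem_uniqF.
  have [|k hk] := @branch_almost_disjoint_seq _ b (rem u0 us) (b u0).
    move=> u us' E0; have /hb' := mem_rem us'; rewrite -E0 hb' // => E1.
    by rewrite -E1 (negbTE urem) in us'.
  apply: (sums_to_zero_coef habs hq Ee hr hsum) => m.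
  have [n [kn mn]] := branch_unbounded (b u0) m k; exists (pickle (mkseq (b u0) n)) => //.
  rewrite (perm_big _ (perm_to_rem u0s)) big_cons /= /ind mem_branch mulr1.
  rewrite big_seq big1 ?addr0 // => u us'.
  by rewrite (negbTE (hk n kn u us')) mulr0.
- apply: card_le_trans (@card_le_real_bool_seq R) _.
  apply: (@card_le_inj _ _ _ _ v) => [b _|b b' _ _ E0]; first by exists b.
  apply: contrapT => nb; have [k hk] := branch_almost_disjoint nb.
  have /eqP := @oner_neq0 K; apply.
  (* If two branches had the same sum, the difference series would have sum 0, yet its coefficient
     is 1 infinitely often along [b]. *)
  have h := sums_to_linear habs hq Ee (-1) (hv b') (hv b).
  rewrite E0 scaleN1r addNr in h.
  apply: (sums_to_zero_coef habs hq Ee hr h) => m.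
  have [n [kn mn]] := branch_unbounded b m k; exists (pickle (mkseq b n)) => //.
  by rewrite /ind mem_branch (negbTE (hk n kn)) mulr0 add0r.
- apply: card_le_trans (card_qcl_seq_span habs hq Ee cK) _.
  exact: card_le_bool_seq_real.
Qed.

End HamelDimension.
(** * Scalars *)

(** The analytic properties shared by the real and the complex scalars: the nonnegative elements of
    [K] are a copy of those of [R], and [K] is complete. *)
Record real_embedding {R : realType} {K : numFieldType} (i : {rmorphism R -> K}) : Prop := {
  emb_ge0 : forall x, (0 <= i x) = (0 <= x);
  emb_onto : forall k : K, 0 <= k -> exists x, k = i x;
  emb_complete : forall u : nat -> K,
    (forall e, 0 < e -> exists N, forall m n, (N <= m)%N -> (N <= n)%N ->
       `|u m - u n| < i e) ->
    exists l, forall e, 0 < e -> exists N, forall n, (N <= n)%N -> `|u n - l| < i e }.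

Section ScalarField.
Variable R : realType.

Let id_embedding : real_embedding (idfun : {rmorphism R -> R}).
Proof.
split=> [x|k _|u hu] //; first by exists k.
have /cauchyP/cauchy_cvg/cvg_ex[l /cvgrPdist_lt ul] : cauchy_ex (u @ \oo).
  move=> e e0; have [N hN] := hu e e0; exists (u N).
  by exists N => // n /= Nn; rewrite /ball /=; apply: hN.
exists l => e e0; have [N _ hN] := ul e e0.
by exists N => n Nn; rewrite distrC; exact: hN.
Qed.

Let complex_embedding : real_embedding (real_complex R : {rmorphism R -> R[i]}).
Proof.
split=> [x|k k0|u hu]; first exact: ler0c.
  by exists (complex.Re k); apply/esym/RRe_real; exact: ger0_real.
have Re_le (z : R[i]) : `|complex.Re z|%:C%C <= `|z| by exact: normc_ge_Re.
have Im_le (z : R[i]) : `|complex.Im z|%:C%C <= `|z|.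
  (* Up to sign, the imaginary part of [z] is the real part of [z * 'i], which has the same
     modulus. *)
  have := normc_ge_Re (z * 'i%C); rewrite ReiNIm normrN normrM.
  by rewrite [X in _ * X]normc_def /= expr0n /= add0r expr1n sqrtr1 mulr1.
have [a ha] : exists a, forall e, 0 < e -> exists N, forall n, (N <= n)%N -> `|complex.Re (u n) - a| < e.
  apply: (emb_complete id_embedding) => e /hu[N hN]; exists N => m n Nm Nn.
  by rewrite /= -raddfB -ltcR; exact: le_lt_trans (Re_le _) (hN m n Nm Nn).
have [b hb] : exists b, forall e, 0 < e -> exists N, forall n, (N <= n)%N -> `|complex.Im (u n) - b| < e.
  apply: (emb_complete id_embedding) => e /hu[N hN]; exists N => m n Nm Nn.
  by rewrite /= -raddfB -ltcR; exact: le_lt_trans (Im_le _) (hN m n Nm Nn).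
exists (a +i* b)%C => e e0.
have e2 : 0 < e / 2 by rewrite divr_gt0.
have [N1 hN1] := ha _ e2; have [N2 hN2] := hb _ e2.
exists (maxn N1 N2) => n; rewrite geq_max => /andP[/hN1 h1 /hN2 h2].
rewrite [u n - _]complexE raddfB [X in _ + _ * X%:C%C]raddfB /=.
apply: le_lt_trans (ler_normD _ _) _.
rewrite normrM [X in X * _]normc_def /= expr0n /= add0r expr1n sqrtr1 mul1r.
rewrite !normc_def /= expr0n /= !addr0 !sqrtr_sqr -raddfD ltcR.
by lra.
Qed.

Lemma embedding_le (K : numFieldType) (i : {rmorphism R -> K}) x y :
  real_embedding i -> (i x <= i y) = (x <= y).
Proof. by move=> hi; rewrite -subr_ge0 -raddfB (emb_ge0 hi) subr_ge0. Qed.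

Lemma embedding_lt (K : numFieldType) (i : {rmorphism R -> K}) x y :
  real_embedding i -> (i x < i y) = (x < y).
Proof. by move=> hi; rewrite !lt_def embedding_le // (inj_eq (fmorph_inj i)). Qed.

Let transport_embedding (K L : numFieldType) (i : {rmorphism R -> K})
  (f : {rmorphism K -> L}) : real_embedding i -> bijective f ->
  (forall z, `|f z| = f `|z|) -> exists j : {rmorphism R -> L}, real_embedding j.
Proof.
move=> hi [g fK gK] fn.
(* An element is nonnegative exactly when it equals its norm, so a morphism commuting with norms
   respects the order. *)
have f_ge0 z : (0 <= f z) = (0 <= z) by rewrite !ger0_def fn (inj_eq (fmorph_inj f)).
have f_lt z w : (f z < f w) = (z < w).
  by rewrite !lt_def (inj_eq (fmorph_inj f)) -subr_ge0 -raddfB f_ge0 subr_ge0.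
exists (f \o i : {rmorphism R -> L}); split=> [x|k|u hu] /=.
- by rewrite f_ge0 (emb_ge0 hi).
- by rewrite -[k]gK f_ge0 => /(emb_onto hi)[x ->]; exists x.
have uE n : u n = f (g (u n)) by rewrite gK.
have [|l hl] := emb_complete hi (u := g \o u).
  move=> e e0; have [N hN] := hu e e0; exists N => m n Nm Nn /=.
  by rewrite -f_lt -fn rmorphB -!uE; exact: hN.
exists (f l) => e e0; have [N hN] := hl e e0; exists N => n Nn.
by rewrite uE -rmorphB fn f_lt; exact: hN.
Qed.

Lemma R_or_C_embedding (K : numFieldType) : R_or_C R K ->
  exists i : {rmorphism R -> K}, real_embedding i.
Proof.
case=> -[f [bf fn]]; first exact: transport_embedding id_embedding bf fn.
exact: transport_embedding complex_embedding bf fn.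
Qed.

Lemma card_R_or_C (K : numFieldType) : R_or_C R K ->
  ([set: K] #<= [set: nat -> bool])%card.
Proof.
case=> -[f [[g fK gK] _]].
  apply: card_le_trans (@card_le_real_bool_seq R).
  by apply: (@card_le_inj _ _ _ _ g) => // x y _ _ /(can_inj gK).
apply: card_le_trans card_le_bool_seq_prod.
apply: card_le_trans (card_le_prod (@card_le_real_bool_seq R) (@card_le_real_bool_seq R)).
apply: (@card_le_inj _ _ _ _ (fun x => (complex.Re (g x), complex.Im (g x)))) => // x y _ _ [h1 h2].
by apply: (can_inj gK); apply/eqP; rewrite eq_complex h1 h2 !eqxx.
Qed.

Section RealPart.
Context {K : numFieldType} (i : {rmorphism R -> K}) (r : K -> R).
Hypothesis hi : real_embedding i.
Hypothesis ri : forall k, 0 <= k -> i (r k) = k.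

Lemma real_part_ge0 k : 0 <= k -> 0 <= r k.
Proof. by move=> k0; rewrite -(emb_ge0 hi) ri. Qed.

Lemma real_part_emb x : 0 <= x -> r (i x) = x.
Proof. by move=> x0; apply: (fmorph_inj i); rewrite ri // (emb_ge0 hi). Qed.

Lemma real_partM k l : 0 <= k -> 0 <= l -> r (k * l) = r k * r l.
Proof.
move=> k0 l0; apply: (fmorph_inj i).
by rewrite rmorphM !ri // mulr_ge0.
Qed.

Lemma real_part_le k x : 0 <= k -> (r k <= x) = (k <= i x).
Proof. by move=> k0; rewrite -[in RHS](ri k0) embedding_le. Qed.

Lemma real_part_lt k x : 0 <= k -> (r k < x) = (k < i x).
Proof. by move=> k0; rewrite -[in RHS](ri k0) embedding_lt. Qed.

Lemma real_part_homo k l : 0 <= k -> k <= l -> r k <= r l.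
Proof. by move=> k0 kl; rewrite real_part_le // ri // (le_trans k0). Qed.

Lemma norm_complete_abs_value : complete_abs_value (fun a : K => r `|a|).
Proof.
split=> [a||| a|a b|e e0|u hu].
- by apply: real_part_ge0.
- by rewrite normr0 -(rmorph0 i) real_part_emb.
- by rewrite normr1 -(rmorph1 i) real_part_emb.
- by move=> /(congr1 i); rewrite ri // rmorph0 => /normr0_eq0.
- by rewrite normrM real_partM.
- exists (i (e / 2)); first by rewrite fmorph_eq0 gt_eqF // divr_gt0.
  have e2 : 0 <= e / 2 by rewrite divr_ge0 // ltW.
  rewrite ger0_norm ?(emb_ge0 hi) // real_part_emb //; lra.
- have [|l hl] := emb_complete hi (u := u).
    move=> e e0; have [N hN] := hu e e0; exists N => m n Nm Nn.
    by rewrite -real_part_lt //; exact: hN.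
  exists l => e e0; have [N hN] := hl e e0; exists N => n Nn.
  by rewrite real_part_lt //; exact: hN.
Qed.

(** On the nonnegative elements of [K], where [qn] takes its values on [E], [r] inverts [i]; so [r]
    turns [qn] into the same quasi-norm with real values. *)
Lemma quasi_banach_complete_quasi_norm (Z : normedModType K) (E : set (nat -> Z))
    (qn : (nat -> Z) -> K) : quasi_banach E qn ->
  exists C, complete_quasi_norm (fun a : K => r `|a|) E (fun v => r (qn v)) C.
Proof.
move=> [hE [q0 [qe0 [qZ [[C [C1 qD]] qc]]]]].
have C0 : 0 <= C by apply: le_trans C1.
exists (r C); split=> //.
- by move=> v /q0; exact: real_part_ge0.
- by move=> v Ev /(congr1 i); rewrite ri ?q0 // rmorph0 => /(qe0 _ Ev).
- by move=> a v Ev; rewrite qZ // real_partM // q0.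
- by rewrite -(embedding_le _ _ hi) rmorph1 ri.
- move=> u v Eu Ev; have [_ [ED _]] := hE.
  rewrite real_part_le ?q0 //; last exact: ED.
  by rewrite rmorphM rmorphD !ri ?q0 //; exact: qD.
- have hEB u v : E u -> E v -> E (u - v) by exact: linear_subspaceB.
  move=> u Eu hu; have [|v [Ev hv]] := qc u Eu.
    move=> e e0; have [|N hN] := hu (r e).
      by rewrite -(embedding_lt _ _ hi) rmorph0 ri // ltW.
    exists N => m n Nm Nn; rewrite -[e]ri ?ltW // -real_part_lt; first exact: hN.
    by apply/q0/hEB.
  exists v; split=> // e e0; have [|N hN] := hv (i e).
    by rewrite -(rmorph0 i) embedding_lt.
  exists N => n Nn; rewrite real_part_lt; first exact: hN.
  by apply/q0/hEB.
Qed.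

End RealPart.
End ScalarField.
(** * Invariant sequence spaces *)

Lemma strictly_incr_lt phi : strictly_incr phi -> {mono phi : m n / (m < n)%N}.
Proof.
move=> h; apply: leqW_mono; apply: leq_mono.
by apply: homo_ltn => //; exact: ltn_trans.
Qed.

Lemma strictly_incr_inj phi : strictly_incr phi -> injective phi.
Proof.
by move=> /strictly_incr_lt h m n E; case: (ltngtP m n) => //; rewrite -h E ltnn.
Qed.

Lemma leq_strictly_incr phi n : strictly_incr phi -> (n <= phi n)%N.
Proof. by move=> h; elim: n => // n IH; exact: leq_ltn_trans (h n). Qed.

Lemma infinite_enumeration (P : nat -> bool) : (forall N, exists j, (N <= j)%N && P j) ->
  exists phi, strictly_incr phi /\ forall j, P j <-> exists k, phi k = j.
Proof.
move=> h.
have /choice[g hg] N : exists j, [/\ (N <= j)%N, P j &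
    forall m, (N <= m)%N -> P m -> (j <= m)%N].
  case: (ex_minnP (h N)) => j /andP[Nj Pj] jmin; exists j; split=> // m Nm Pm.
  by apply: jmin; rewrite Nm.
(* Each term is the least index satisfying [P] beyond the preceding term. *)
pose phi k := iter k (fun j => g j.+1) (g 0%N).
have phiS : strictly_incr phi by move=> k; rewrite /phi iterS; case: (hg (phi k).+1).
exists phi; split=> // j; split=> [Pj|[[|k] <-]]; last 2 first.
- by case: (hg 0%N).
- by rewrite /phi iterS; case: (hg (phi k).+1).
have ex : exists k, (j <= phi k)%N by exists j; exact: leq_strictly_incr.
case: (ex_minnP ex) => -[|k] jk kmin; [exists 0%N|exists k.+1].
  by apply/eqP; rewrite eqn_leq jk andbT; case: (hg 0%N) => _ _; apply.
apply/eqP; rewrite eqn_leq jk andbT.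
rewrite /phi iterS; case: (hg (phi k).+1) => _ _; apply => //.
by rewrite ltnNge; apply/negP => /kmin; rewrite ltnn.
Qed.

Definition mask_seq {Z : nmodType} (A : nat -> bool) (u : nat -> Z) : nat -> Z :=
  fun j => if A j then u j else 0.

Section Sequences.
Context {K : numFieldType} {Z : normedModType K}.
Implicit Types (u x y : nat -> Z) (E : set (nat -> Z)) (qn : (nat -> Z) -> K).

Lemma support_enumeration x : ~ finitely_supported x ->
  exists phi, strictly_incr phi /\ forall j, x j != 0 <-> exists k, phi k = j.
Proof.
move=> nx; apply: infinite_enumeration => N; apply: contrapT => h; apply: nx.
exists N => j Nj; apply/eqP; apply: contrapT => xj; apply: h.
by exists j; rewrite Nj; apply/negP.
Qed.

Lemma spread_exists (phi : nat -> nat) y : strictly_incr phi ->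
  exists x, (forall k, x (phi k) = y k) /\ forall j, ~ (exists k, phi k = j) -> x j = 0.
Proof.
move=> hphi; have /choice[x hx] j : exists z, (forall k, phi k = j -> z = y k) /\
    (~ (exists k, phi k = j) -> z = 0).
  have [[k kj]|nk] := pselect (exists k, phi k = j).
    exists (y k); split=> [k' k'j|//]; last by case; exists k.
    by congr y; apply: (strictly_incr_inj hphi); rewrite kj.
  by exists 0; split=> // k kj; case: nk; exists k.
by exists x; split=> [k|j]; [apply: (proj1 (hx _))|exact: (proj2 (hx _))].
Qed.

(** Here [phi] enumerates the support, which is therefore infinite, so that [x] along [phi] is the
    zero-free version of [x]. *)
Lemma inv_seq_space_zero_free E qn x phi : inv_seq_space E qn -> strictly_incr phi ->
  (forall j, x j != 0 <-> exists k, phi k = j) -> E x <-> E (fun k => x (phi k)).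
Proof.
move=> [_ [_ [_ [[K0 hK0] _]]]] hphi hx.
have xphi k : x (phi k) != 0 by apply/hx; exists k.
apply: (proj1 (hK0 x _ _ _)).
  right; split; last by exists phi.
  by move=> [N /(_ _ (leq_strictly_incr N hphi))] /eqP; apply/negP.
apply/eqP => /(congr1 (fun h => h 0%N)) /= /eqP; exact/negP.
Qed.

(** Unless it is finitely supported, the masked sequence has a subsequence of [u] as its zero-free
    version. *)
Lemma sinv_mask E qn A u : strongly_inv_seq_space E qn -> E u -> E (mask_seq A u).
Proof.
move=> [hE [c00 sub]] Eu.
have [/c00//|/support_enumeration[phi [hphi hu]]] := pselect (finitely_supported (mask_seq A u)).
apply/(inv_seq_space_zero_free hE hphi hu).
rewrite (_ : (fun k => _) = fun k => u (phi k)); first by move/sub : Eu; apply.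
apply: funext => k; have /hu : exists k', phi k' = phi k by exists k.
by rewrite /mask_seq; case: ifP => //; rewrite eqxx.
Qed.

(** As [phi] reaches the whole support, the zero-free version of [u] is a subsequence of [u] along
    [phi]. *)
Lemma sinv_of_subseq E qn u phi : strongly_inv_seq_space E qn -> strictly_incr phi ->
  (forall j, u j != 0 -> exists k, phi k = j) -> E (fun k => u (phi k)) -> E u.
Proof.
move=> [hE [c00 sub]] hphi supu Eu.
have [/c00//|/support_enumeration[th [hth hu]]] := pselect (finitely_supported u).
apply/(inv_seq_space_zero_free hE hth hu).
have /choice[tau htau] k : exists t, phi t = th k by apply/supu/hu; exists k.
rewrite (_ : (fun k => _) = fun k => u (phi (tau k))); last first.
  by apply: funext => k; rewrite htau.
move/sub : Eu; apply => k.
by rewrite -(strictly_incr_lt hphi) !htau.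
Qed.

End Sequences.

(** * Weak sequence spaces: masks, subsequences and scaling *)

Section WeakSequences.
Context {K : numFieldType} {X Y : normedModType K}.
Variables (F : set (nat -> K)) (qF : (nat -> K) -> K).
Hypothesis hF : strongly_inv_seq_space F qF.
Implicit Types (y : nat -> Y) (A : nat -> bool).

Lemma dual_elt0 (phi : Y -> K) : dual_elt phi -> phi 0 = 0.
Proof.
move=> [lin _]; have := lin 1 0 0; rewrite scaler0 addr0 mul1r => /eqP.
by rewrite -subr_eq subrr => /eqP/esym.
Qed.

Lemma weak_seq_mask A y : weak_seq F y -> weak_seq F (mask_seq A y).
Proof.
move=> Fy phi hphi; have := sinv_mask A hF (Fy phi hphi).
congr F; apply: funext => j; rewrite /mask_seq.
by case: ifP => // _; rewrite dual_elt0.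
Qed.

Lemma weak_seq_split A y : weak_seq F (mask_seq A y) ->
  weak_seq F (mask_seq (fun j => ~~ A j) y) -> weak_seq F y.
Proof.
move=> h1 h2 phi hphi.
have [[_ [[[_ [FD _]] _] _]] _] := hF.
have := FD _ _ (h1 phi hphi) (h2 phi hphi); congr F; apply: funext => j.
rewrite /mask_seq; change ((phi (if A j then y j else 0) + phi (if ~~ A j then y j else 0)) = phi (y j)).
by case: (A j) => /=; rewrite dual_elt0 // ?addr0 ?add0r.
Qed.

Lemma weak_seq_subseq y psi : strictly_incr psi -> weak_seq F y ->
  weak_seq F (fun k => y (psi k)).
Proof.
move=> hpsi Fy phi hphi; have [_ [_ sub]] := hF.
by have /sub := Fy phi hphi; apply.
Qed.

Lemma weak_seq_of_subseq y psi : strictly_incr psi ->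
  (forall j, y j != 0 -> exists k, psi k = j) ->
  weak_seq F (fun k => y (psi k)) -> weak_seq F y.
Proof.
move=> hpsi supy Fy phi hphi; apply: (sinv_of_subseq hF hpsi _ (Fy phi hphi)) => j.
move=> pj; apply: supy; apply: contraNN pj => /eqP ->.
by rewrite dual_elt0.
Qed.

Lemma weak_seq_finitely_supported y : finitely_supported y -> weak_seq F y.
Proof.
move=> [N yN] phi hphi; have [_ [c00 _]] := hF; apply: c00; exists N => j /yN ->.
exact: dual_elt0.
Qed.

Lemma weak_seq_scale (f : X -> Y) (x : nat -> X) (a : K) : strongly_compatible f F ->
  a != 0 -> weak_seq F (fun j => f (a *: x j)) -> weak_seq F (fun j => f (x j)).
Proof.
move=> [_ hf] a0 h phi hphi; apply: contrapT => nF.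
by have [_ /(_ _ _ a0 nF)] := hf phi hphi; apply; exact: h.
Qed.

End WeakSequences.

(** * Closed subspaces of an invariant sequence space *)

Section InvariantSequenceSpace.
Context {R : realType} {K : numFieldType} {X : normedModType K}.
Variables (i : {rmorphism R -> K}) (r : K -> R).
Hypothesis hi : real_embedding i.
Hypothesis ri : forall k, 0 <= k -> i (r k) = k.
Variables (E : set (nat -> X)) (qE : (nat -> X) -> K).
Hypothesis hE : inv_seq_space E qE.

Let absK (a : K) := r `|a|.
Let q (v : nat -> X) := r (qE v).

Let habs : complete_abs_value absK := norm_complete_abs_value hi ri.

Let E_linear : linear_subspace E.
Proof. by have [_ [[]]] := hE. Qed.

Let qE_ge0 v : E v -> 0 <= qE v.
Proof. by have [_ [[_ [h _]] _]] := hE; exact: h. Qed.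

Lemma norm_coord_le v j : E v -> r `|v j| <= q v.
Proof.
move=> Ev; have [_ [_ [_ [_ h]]]] := hE.
by apply: (real_part_homo hi ri) => //; exact: h.
Qed.

Lemma qcl_qn_closed (W : set (nat -> X)) : W `<=` E ->
  qn_closed E qE (qcl E q W).
Proof.
have [_ [qb _]] := hE; have [C hq] := quasi_banach_complete_quasi_norm hi ri qb.
move=> WE x Ex hx; apply: (qcl_idem hq WE); split=> // e e0.
have [|w [ww hw]] := hx (i e); first by rewrite -(rmorph0 i) embedding_lt.
exists w; split=> //; rewrite /q (real_part_lt hi ri) //.
by apply: qE_ge0; apply: linear_subspaceB => //; case: ww.
Qed.

Definition vanishing_on (A : nat -> bool) : set (nat -> X) :=
  [set v | E v /\ forall j, A j -> v j = 0].

Lemma vanishing_on_linear A : linear_subspace (vanishing_on A).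
Proof.
have [E0 [ED EZ]] := E_linear; split; last split; first by [].
- move=> u v [Eu u0] [Ev v0]; split=> [|j Aj]; first exact: ED.
  change (u j + v j = 0); by rewrite u0 // v0 // addr0.
- move=> a u [Eu u0]; split=> [|j Aj]; first exact: EZ.
  change (a *: u j = 0); by rewrite u0 // scaler0.
Qed.

(** Coordinates are dominated by [q]: an approximant closer to [v] than the norm of a nonzero [v j]
    cannot vanish at [j]. *)
Lemma vanishing_on_closed A : qcl E q (vanishing_on A) `<=` vanishing_on A.
Proof.
move=> v [Ev hv]; split=> // j Aj; apply/eqP; apply: contrapT => /negP vj.
have [|w [[Ew w0] hw]] := hv (r `|v j|).
  by rewrite -(embedding_lt _ _ hi) rmorph0 ri // normr_gt0.
have := le_lt_trans (norm_coord_le j (linear_subspaceB E_linear Ev Ew)) hw.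
change (r `|v j - w j| < r `|v j| -> False).
by rewrite w0 // subr0 ltxx.
Qed.

(* Proportionality to [x] on [A] is the condition of lying in a closed subspace extended
   by one line, hence it passes to limits. *)
Lemma line_ext_vanishing_closed A x : E x ->
  qcl E q (line_ext (vanishing_on A) x) `<=` line_ext (vanishing_on A) x.
Proof.
have [_ [qb _]] := hE; have [C hq] := quasi_banach_complete_quasi_norm hi ri qb.
apply: (line_ext_closed habs hq); first exact: vanishing_on_linear.
  by move=> v [].
exact: vanishing_on_closed.
Qed.

Lemma line_ext_vanishingE A (x w : nat -> X) a j :
  vanishing_on A (w - a *: x) -> A j -> w j = a *: x j.
Proof.
move=> [_ h] /h; change (w j - a *: x j = 0 -> w j = a *: x j).
by move/eqP; rewrite subr_eq0 => /eqP.
Qed.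

Lemma hamel_dim_closed_seq_span (e : nat -> nat -> X) : R_or_C R K ->
  (forall n, E (e n)) -> (forall n, ~ fin_span e n (e n)) ->
  let W := qcl E q (seq_span e) in
  [/\ linear_subspace W, W `<=` E, qn_closed E qE W & hamel_dim_eq W [set: R]].
Proof.
move=> hK Ee ef W.
have [_ [qb _]] := hE; have [C hq] := quasi_banach_complete_quasi_norm hi ri qb.
have sE : seq_span e `<=` E by exact: seq_span_sub.
split.
- by apply: (qcl_linear habs hq) => //; exact: seq_span_linear.
- by move=> v [].
- exact: qcl_qn_closed.
- by apply: (hamel_dim_qcl_seq_span habs hq) => //; exact: card_R_or_C hK.
Qed.

Lemma seq_span_qcl (e : nat -> nat -> X) n : (forall n, E (e n)) -> qcl E q (seq_span e) (e n).
Proof.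
move=> Ee; have [_ [qb _]] := hE; have [C hq] := quasi_banach_complete_quasi_norm hi ri qb.
by apply: (sub_qcl habs hq); [exact: seq_span_sub|exact: seq_span_gen].
Qed.

Lemma ex_independent_seq x : E x -> exists e : nat -> nat -> X,
  [/\ forall n, E (e n), forall n, ~ fin_span e n (e n) & seq_span e x].
Proof.
move=> Ex; have [_ [_ [infE _]]] := hE.
(* [g] extends a finite list by a vector outside its span, which exists because [E] is
   infinite-dimensional. The last clause starts the sequence with [x] when [x] is nonzero, to have
   [x] in the span. *)
have /choice[g hg] (s : seq (nat -> X)) : exists v, (forall u, u \in s -> E u) ->
    [/\ E v, ~ Defs.span [set u | u \in s] v & s = [::] -> x != 0 -> v = x].
  have [sE|nE] := pselect (forall u, u \in s -> E u); last by exists 0.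
  have [[-> x0]|nx] := pselect (s = [::] /\ x != 0).
    exists x => _; split=> //.
    have h : Defs.span [set u | u \in ([::] : seq (nat -> X))] `<=` fin_span (fun=> 0) 0.
      by apply: span_sub; [exact: fin_span_linear|].
    by move/h; rewrite fin_span0 => /eqP; exact/negP.
  apply: contrapT => nv; apply: infE; exists s => w; split=> [Ew|]; last first.
    by apply: span_sub => // u; exact: sE.
  apply: contrapT => nw; apply: nv; exists w => _; split=> // s0 x0.
  by case: nx.
pose S n := iter n (fun s => rcons s (g s)) [::].
have SE n u : u \in S n -> E u.
  elim: n u => [|n IH] u //; rewrite /S iterS -/(S n) mem_rcons inE => /orP[/eqP ->|/IH//].
  by have [] := hg _ IH.
have Sg n k : (k < n)%N -> g (S k) \in S n.
  elim: n => // n IH; rewrite ltnS leq_eqVlt /S iterS -/(S n) mem_rcons inE.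
  by move=> /orP[/eqP ->|/IH ->]; rewrite ?eqxx ?orbT.
exists (fun n => g (S n)); split=> [n|n|].
- by have [] := hg _ (SE n).
- have [_ h _] := hg _ (SE n); move=> he; apply: h; move: he.
  apply: fin_span_sub; first exact: span_linear.
  by move=> k kn; apply: sub_span; exact: Sg.
- have [->|x0] := eqVneq x 0; first by case: (seq_span_linear (fun n => g (S n))).
  have [_ _ h] := hg _ (SE 0%N); rewrite -(h erefl x0).
  exact: (seq_span_gen (fun n => g (S n)) 0).
Qed.

(** * Disjoint copies of a sequence and the spaces they span *)

Section Spread.
Context {Y : normedModType K} {Gam : Type}.
Variables (F : Gam -> set (nat -> K)) (qF : Gam -> (nat -> K) -> K).
Hypothesis hF : forall l, strongly_inv_seq_space (F l) (qF l).
Variable f : X -> Y.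
Hypothesis hf : forall l, strongly_compatible f (F l).
Hypothesis hnest : nested (fun l => @weak_seq K Y (F l)).

Lemma nested_mask (y : nat -> Y) (A : nat -> bool) :
  ~ (exists l, weak_seq (F l) y) ->
  exists eps : bool, ~ exists l, weak_seq (F l) (mask_seq (fun j => A j == eps) y).
Proof.
move=> ny; apply: contrapT => h.
have /choice[l hl] eps : exists l, weak_seq (F l) (mask_seq (fun j => A j == eps) y).
  by apply: contrapT => h'; apply: h; exists eps.
suff [l0 h1 h2] : exists2 l0, weak_seq (F l0) (mask_seq (fun j => A j == true) y) &
    weak_seq (F l0) (mask_seq (fun j => A j == false) y).
  apply: ny; exists l0; apply: (weak_seq_split (hF l0) h1).
  by congr (weak_seq _ (mask_seq _ _)) : h2; apply: funext => j; case: (A j).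
(* The larger of the two spaces contains both halves. *)
have [h1|h1] := hnest (l true) (l false).
  by exists (l false); [apply: h1|]; exact: hl.
by exists (l true); [|apply: h1]; exact: hl.
Qed.

(* [A] is the set of even or of odd indices. The block [P n] consists of indices of the
   other parity, and [y n] is the zero-free version of [x] spread along [P n]. *)
Lemma ex_disjoint_copies x (l0 : Gam) : Gw E f F x ->
  exists (A : nat -> bool) (P : nat -> nat -> bool) (y : nat -> nat -> X),
  [/\ ~ (exists l, weak_seq (F l) (mask_seq A (fun j => f (x j)))),
      forall j, ~~ A j -> exists n, P n j,
      forall n j, P n j -> ~~ A j /\ forall m, P m j -> m = n,
      forall n, [/\ E (y n), exists2 j, P n j & y n j != 0 & forall j, ~~ P n j -> y n j = 0] &
      forall n, ~ exists l, weak_seq (F l) (fun j => f (y n j))].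
Proof.
move=> [Ex nx]; have f0 : f 0 = 0 by have [] := hf l0.
have [|phi [hphi suppx]] := @support_enumeration _ _ x.
  move=> [N xN]; apply: nx; exists l0; apply: (weak_seq_finitely_supported (hF l0)).
  by exists N => j /xN ->.
have [eps heps] := nested_mask odd nx.
(* Decoding [m] as a pair and keeping the first component gives each label to infinitely many [m];
   numbers that code no pair get the label 0. *)
pose label m := if unpickle m is Some p then (p : nat * nat).1 else 0%N.
pose P n j := (odd j != eps) && (label j./2 == n).
have /choice[psi hpsi] n : exists psi, strictly_incr psi /\
    forall j, P n j <-> exists k, psi k = j.
  apply: infinite_enumeration => N.
  have [|k [_ Nk]] := @injective_unbounded (fun k => pickle (n, k)) N 0.
    by move=> k k' /(pcan_inj pickleK) [].
  exists (~~ eps + (pickle (n, k)).*2)%N; rewrite /P half_bit_double /label pickleK eqxx.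
  rewrite oddD odd_double addbF oddb andbT; apply/andP; split; last by case: (eps).
  by apply: leq_trans Nk _; rewrite -addnn addnA leq_addl.
have /choice[y hy] n := @spread_exists _ _ (psi n) (fun k => x (phi k)) (proj1 (hpsi n)).
have xphi k : x (phi k) != 0 by apply/suppx; exists k.
have suppy n j : y n j != 0 <-> exists k, psi n k = j.
  split=> [|[k <-]]; last by rewrite (proj1 (hy n)).
  by move=> yj; apply: contrapT => /(proj2 (hy n)) /eqP; apply/negP.
exists (fun j => odd j == eps), P, y; split=> // [j Aj|n j /andP[Aj /eqP lj]|n|n].
- by exists (label j./2); rewrite /P Aj eqxx.
- by split=> // m /andP[_ /eqP]; rewrite lj.
- split.
  + apply/(inv_seq_space_zero_free hE (proj1 (hpsi n)) (suppy n)).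
    rewrite (_ : (fun k => _) = fun k => x (phi k)).
      by apply/(inv_seq_space_zero_free hE hphi suppx).
    by apply: funext => k; rewrite (proj1 (hy n)).
  + exists (psi n 0); first by apply/(proj2 (hpsi n)); exists 0%N.
    by rewrite (proj1 (hy n)).
  + by move=> j nP; apply: (proj2 (hy n)) => /(proj2 (hpsi n)); apply/negP.
(* Along the support of [x], the sequence [f (x j)] is a subsequence of [f (y n j)], and outside
   this support it vanishes since [f 0 = 0]. *)
- move=> [l hl]; apply: nx; exists l.
  apply: (weak_seq_of_subseq (hF l) hphi) => [j fj|].
    by apply/suppx; apply: contraNN fj => /eqP ->; rewrite f0.
  have := weak_seq_subseq (hF l) (proj1 (hpsi n)) hl.
  by congr weak_seq; apply: funext => k; rewrite (proj1 (hy n)).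
Qed.

Lemma ex_spaceable_seq x (l0 : Gam) : Gw E f F x -> exists e : nat -> nat -> X,
  [/\ forall n, E (e n), forall n, ~ fin_span e n (e n), e 0%N = x &
      qcl E q (seq_span e) `<=` Gw E f F `|` [set 0]].
Proof.
move=> Gx; have [Ex nx] := Gx; have f0 : f 0 = 0 by have [] := hf l0.
have [A [P [y [nA cover disj hy nfy]]]] := ex_disjoint_copies l0 Gx.
pose e n := if n is m.+1 then y m else x.
have Ee n : E (e n) by case: n => [|n] //=; case: (hy n).
(* If [x] vanished on [A], then [f (x j)] masked by [A] would be zero and so would belong to the
   spaces of the family. *)
have [j0 Aj0 xj0] : exists2 j, A j & x j != 0.
  apply: contrapT => h; apply: nA; exists l0.
  apply: (weak_seq_finitely_supported (hF l0)); exists 0%N => j _; rewrite /mask_seq.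
  case: ifP => // Aj; have [->//|xj] := eqVneq (x j) 0; by case: h; exists j.
have yA n j : A j -> y n j = 0.
  have [_ _ h] := hy n; move=> Aj; apply: h; apply/negP => /disj[].
  by rewrite Aj.
exists e; split=> // [n|w ww].
  case: n => [|m].
    by rewrite fin_span0 /= => /(congr1 (fun h => h j0)) /eqP; exact/negP.
  (* To see that [y m] is not spanned by its predecessors, it is tested on [A] and at one index [j1]
     of its own block. At [j0] in [A] the multiple of [x] must be 0, and at [j1] all earlier copies
     vanish while [y m] does not. *)
  have [_ [j1 Pj1 yj1] _] := hy m.
  pose B j := A j || (j == j1).
  have h : fin_span e m.+1 `<=` line_ext (vanishing_on B) x.
    apply: fin_span_sub; first exact/line_ext_linear/vanishing_on_linear.
    case=> [|n] nm; first exact/line_ext_gen/vanishing_on_linear.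
    apply: sub_line_ext; split=> [|j]; first exact: Ee.
    change (B j -> y n j = 0); move=> /orP[/yA ->//|/eqP ->]; have [_ _] := hy n; apply.
    apply/negP => Pn; have [_ /(_ _ Pn) nE] := disj _ _ Pj1.
    by move: nm; rewrite nE ltnn.
  move=> /h[a ha]; have a0 : a = 0.
    have := @line_ext_vanishingE _ _ _ _ j0 ha; rewrite /B Aj0 /= yA // => /(_ isT)/esym/eqP.
    by rewrite scaler_eq0 (negbTE xj0) orbF => /eqP.
  have := @line_ext_vanishingE _ _ _ _ j1 ha; rewrite /B eqxx orbT a0 scale0r => /(_ isT) /eqP.
  exact/negP.
have Ew : E w by case: ww.
have se : seq_span e `<=` line_ext (seq_span y) x.
  apply: seq_span_sub; first exact/line_ext_linear/seq_span_linear.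
  case=> [|n]; first exact/line_ext_gen/seq_span_linear.
  by apply/sub_line_ext/seq_span_gen.
have [_ [qb _]] := hE; have [C hq] := quasi_banach_complete_quasi_norm hi ri qb.
have [a ha] : line_ext (qcl E q (seq_span y)) x w.
  apply: (qcl_line_ext habs hq); [exact: seq_span_linear| |by []|exact: qcl_mono ww].
  by apply: seq_span_sub => // n; exact: (Ee n.+1).
have [w0|w0] := eqVneq w 0; [by right|left; split=> // -[l hl]].
have hA : vanishing_on A (w - a *: x).
  apply: vanishing_on_closed; apply: qcl_mono ha.
  apply: seq_span_sub; first exact: vanishing_on_linear.
  by move=> n; split=> [|j]; [exact: (Ee n.+1)|exact: yA].
(* On [A] all copies vanish, so there [w] is [a *: x]; for nonzero [a], compatibility carries
   membership of the masked [f (w j)] over to the masked [f (x j)]. *)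
have [a0|a0] := eqVneq a 0; last first.
  apply: nA; exists l.
  rewrite (_ : mask_seq _ _ = fun j => f (mask_seq A x j)); last first.
    by apply: funext => j; rewrite /mask_seq; case: ifP.
  apply: (weak_seq_scale (hf l) a0); have := weak_seq_mask (hF l) A hl.
  congr weak_seq; apply: funext => j; rewrite /mask_seq.
  by case: ifP => [/(line_ext_vanishingE hA) ->//|_]; rewrite scaler0 f0.
(* When [a = 0], [w] vanishes on [A], so a nonzero coordinate lies in some block [P n]. There [w] is
   a multiple of [y n], and the multiple is nonzero because of that coordinate. *)
have [j wj] : exists j, w j != 0.
  apply: contrapT => h; move/eqP: w0; apply; apply: funext => j.
  by apply/eqP; apply: contrapT => /negP wj; apply: h; exists j.
have [n Pj] : exists n, P n j.
  apply: cover; apply: contraNN wj => /(line_ext_vanishingE hA) ->.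
  by rewrite a0 scale0r.
rewrite a0 scale0r subr0 in ha.
have [Ey _ yP] := hy n.
have [b hb] : line_ext (vanishing_on (P n)) (y n) w.
  apply: (line_ext_vanishing_closed Ey); apply: qcl_mono ha.
  apply: seq_span_sub; first exact/line_ext_linear/vanishing_on_linear.
  move=> m; have [->|mn] := eqVneq m n; first exact/line_ext_gen/vanishing_on_linear.
  apply: sub_line_ext; split=> [|k Pk]; first exact: (Ee m.+1).
  have [_ _] := hy m; apply; apply: contraNN mn => Pm.
  by have [_ /(_ _ Pm) ->] := disj _ _ Pk.
have b0 : b != 0.
  by apply: contraNN wj => /eqP b0; rewrite (line_ext_vanishingE hb Pj) b0 scale0r.
apply: (nfy n); exists l; apply: (weak_seq_scale (hf l) b0).
have := weak_seq_mask (hF l) (P n) hl.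
congr weak_seq; apply: funext => k; rewrite /mask_seq.
case: ifP => [/(line_ext_vanishingE hb) ->//|nP].
by rewrite yP ?nP // scaler0 f0.
Qed.

End Spread.
End InvariantSequenceSpace.
Theorem mainTheorem3 (R : realType) (K : numFieldType) (hK : R_or_C R K)
  (X Y : completeNormedModType K) (Gam : Type)
  (E : set (nat -> X)) (qE : (nat -> X) -> K) (hE : inv_seq_space E qE)
  (F : Gam -> set (nat -> K)) (qF : Gam -> (nat -> K) -> K)
  (hF : forall l, strongly_inv_seq_space (F l) (qF l))
  (f : X -> Y) (hf : forall l, strongly_compatible f (F l))
  (hnest : nested (fun l => @weak_seq K Y (F l))) :
  Gw E f F = set0 \/
  forall x, Gw E f F x ->
    exists W : set (nat -> X),
      linear_subspace W /\ W `<=` E /\ qn_closed E qE W /\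
      hamel_dim_eq W [set: R] /\
      W x /\ W `<=` Gw E f F `|` [set 0].
Proof.
(* The second alternative holds vacuously when the set is empty. *)
right=> x Gx; have [Ex nx] := Gx.
have [i hi] := R_or_C_embedding hK.
have /choice[r ri] k : exists t, 0 <= k -> i t = k.
  have [/(emb_onto hi)[t ->]|nk] := pselect (0 <= k); first by exists t.
  by exists 0 => /nk.
have [e [Ee ef xW WG]] : exists e : nat -> nat -> X,
    let W := qcl E (fun v => r (qE v)) (seq_span e) in
    [/\ forall n, E (e n), forall n, ~ fin_span e n (e n), W x &
        W `<=` Gw E f F `|` [set 0]].
  (* For an empty family the set is all of [E], and any independent sequence whose span contains [x]
     serves. *)
  have [[l0 _]|nG] := pselect (exists l : Gam, True).
    have [e [Ee ef e0 WG]] := ex_spaceable_seq hi ri hE hF hf hnest l0 Gx.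
    by exists e; split=> //; rewrite -e0; apply: (seq_span_qcl hi ri hE).
  have [e [Ee ef xe]] := ex_independent_seq hE Ex.
  have [_ [qb _]] := hE; have [C hq] := quasi_banach_complete_quasi_norm hi ri qb.
  exists e; split=> //.
    apply: (sub_qcl (norm_complete_abs_value hi ri) hq) xe.
    by apply: seq_span_sub => //; exact: qn_space hq.
  by move=> w [Ew _]; left; split=> // -[l _]; apply: nG; exists l.
have [W1 W2 W3 W4] := hamel_dim_closed_seq_span hi ri hE hK Ee ef.
by exists (qcl E (fun v => r (qE v)) (seq_span e)).
Qed.
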